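(* Let $\mathbb F=\mathbb R$ or $\mathbb C$. Every pair $(A,B)$ of $m\times n$ matrices over $\mathbb F$ is topologically equivalent to a direct sum \[(I_r,D)\oplus(M_1,N_1)\oplus\dots\oplus(M_t,N_t),\] in which $D$ is an $r\times r$ nonsingular matrix and each $(M_i,N_i)$ is one of the pairs $(I_k,J_k(0))$, $(J_k(0),I_k)$, $(L_k,R_k)$, $(L_k^T,R_k^T)$, $k\ge1$. Moreover, if $(A,B)$ is topologically equivalent to two such direct sums $(I_r,D)\oplus(M_1,N_1)\oplus\dots\oplus(M_t,N_t)$ and $(I_{r'},D')\oplus(M'_1,N'_1)\oplus\dots\oplus(M'_{t'},N'_{t'})$, then $r=r'$, $D$ and $D'$ are topologically similar, $t=t'$, and after a reindexing $(M_i,N_i)=(M'_i,N'_i)$ for all $i$.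
   Context: $J_k(0)$ denotes the $k\times k$ nilpotent Jordan block with ones directly below the diagonal and zeros elsewhere. $L_k$ and $R_k$ are the $(k-1)\times k$ matrices obtained from $I_k$ by deleting its last row, respectively its first row; in particular $L_1=R_1$ is the $0\times 1$ matrix (the matrix of the map $\mathbb F\to 0$) and $L_1^T=R_1^T$ is the $1\times 0$ matrix. The direct sum of matrix pairs is $(A,B)\oplus(A',B')=(A\oplus A',B\oplus B')$ with block-diagonal matrices. $\mathbb F^n$ carries its usual norm topology, and each matrix $A\in\mathbb F^{m\times n}$ is identified with the linear map $\mathbb F^n\to\mathbb F^m$, $v\mapsto Av$. Two pairs $(A,B)$ ($m\times n$) and $(A',B')$ ($m'\times n'$) are topologically equivalent if there exist homeomorphisms $\varphi:\mathbb F^n\to\mathbb F^{n'}$ and $\psi:\mathbb F^m\to\mathbb F^{m'}$ with $\psi A=A'\varphi$ and $\psi B=B'\varphi$. Two $r\times r$ matrices $D,D'$ are topologically similar if there is a homeomorphism $\varphi:\mathbb F^r\to\mathbb F^r$ with $\varphi D=D'\varphi$. *)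

(* Defs.v *)
From Stdlib Require Import Reals List Permutation.
From mathcomp Require Import ssreflect ssrfun ssrbool eqtype ssrnat fintype bigop.

Unset Strict Implicit.
Unset Printing Implicit Defensive.

Record scalars := Scalars {
  sc :> Type;
  sadd : sc -> sc -> sc;
  smul : sc -> sc -> sc;
  szero : sc;
  sone : sc;
  sdist : sc -> sc -> R
}.

Definition RScalars : scalars :=
  @Scalars R Rplus Rmult 0%R 1%R (fun x y => Rabs (x - y)).

Definition Cadd (x y : R * R) : R * R := (fst x + fst y, snd x + snd y)%R.
Definition Cmul (x y : R * R) : R * R :=
  (fst x * fst y - snd x * snd y, fst x * snd y + snd x * fst y)%R.
Definition Cdist (x y : R * R) : R :=
  sqrt ((fst x - fst y) * (fst x - fst y) + (snd x - snd y) * (snd x - snd y))%R.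
Definition CScalars : scalars :=
  @Scalars (R * R) Cadd Cmul (0%R, 0%R) (1%R, 0%R) Cdist.

Inductive base_field := RealField | ComplexField.
Definition scal (k : base_field) : scalars :=
  match k with RealField => RScalars | ComplexField => CScalars end.

Section Matrices.
Variable F : scalars.

Definition vec (n : nat) := 'I_n -> F.
Definition mat (m n : nat) := 'I_m -> 'I_n -> F.

Definition mulmv m n (A : mat m n) (v : vec n) : vec m :=
  fun i => \big[(@sadd F) / (@szero F)]_(j < n) @smul F (A i j) (v j).

Arguments mulmv {m n} A v i.

Definition mulmm m n p (A : mat m n) (B : mat n p) : mat m p :=
  fun i k => \big[(@sadd F) / (@szero F)]_(j < n) @smul F (A i j) (B j k).
Arguments mulmm {m n p} A B i k.

Definition idm (k : nat) : mat k k :=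
  fun i j => if (i : nat) == j then @sone F else @szero F.

Definition nonsingular r (D : mat r r) : Prop :=
  exists E : mat r r, mulmm D E = @idm r /\ mulmm E D = @idm r.
Arguments nonsingular {r} D.

(* norm topology on F^n (sup-norm metric; all norms are equivalent) *)
Definition vdist n (x y : vec n) : R :=
  \big[Rmax / 0%R]_(i < n) @sdist F (x i) (y i).
Arguments vdist {n} x y.

Definition continuous_map n n' (f : vec n -> vec n') : Prop :=
  forall (x : vec n) (eps : R), (0 < eps)%R ->
    exists delta : R, (0 < delta)%R /\
      forall y : vec n, (vdist y x < delta)%R -> (vdist (f y) (f x) < eps)%R.
Arguments continuous_map {n n'} f.

Definition homeomorphism n n' (f : vec n -> vec n') : Prop :=
  exists g : vec n' -> vec n,
    continuous_map f /\ continuous_map g /\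
    (forall x, g (f x) = x) /\ (forall y, f (g y) = y).
Arguments homeomorphism {n n'} f.

Record mpair := MPair { pm : nat; pn : nat; pA : mat pm pn; pB : mat pm pn }.

Definition top_equiv (P Q : mpair) : Prop :=
  exists (phi : vec (pn P) -> vec (pn Q)) (psi : vec (pm P) -> vec (pm Q)),
    homeomorphism phi /\ homeomorphism psi /\
    (forall v, psi (mulmv (pA P) v) = mulmv (pA Q) (phi v)) /\
    (forall v, psi (mulmv (pB P) v) = mulmv (pB Q) (phi v)).

Definition top_similar r r' (D : mat r r) (D' : mat r' r') : Prop :=
  exists phi : vec r -> vec r',
    homeomorphism phi /\ (forall v, phi (mulmv D v) = mulmv D' (phi v)).
Arguments top_similar {r r'} D D'.

Definition dsum_mat m n m' n' (A : mat m n) (A' : mat m' n') : mat (m + m') (n + n') :=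
  fun i j => match split i, split j with
             | inl i1, inl j1 => A i1 j1
             | inr i2, inr j2 => A' i2 j2
             | _, _ => @szero F
             end.

Arguments dsum_mat {m n m' n'} A A' i j.

Definition dsum (P Q : mpair) : mpair :=
  @MPair (pm P + pm Q) (pn P + pn Q) (dsum_mat (pA P) (pA Q)) (dsum_mat (pB P) (pB Q)).

Definition empty_pair : mpair := @MPair 0 0 (fun i _ => @szero F) (fun i _ => @szero F).

Definition Jnil (k : nat) : mat k k :=
  fun i j => if (i : nat) == j.+1 then @sone F else @szero F.
Definition Lmat (k : nat) : mat k.-1 k :=
  fun i j => if (i : nat) == j then @sone F else @szero F.
Definition Rmat (k : nat) : mat k.-1 k :=
  fun i j => if (j : nat) == i.+1 then @sone F else @szero F.
Definition LmatT (k : nat) : mat k k.-1 := fun i j => @Lmat k j i.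
Definition RmatT (k : nat) : mat k k.-1 := fun i j => @Rmat k j i.

Inductive canon :=
  | CIJ of nat
  | CJI of nat
  | CLR of nat
  | CLRT of nat.

Definition canon_size (c : canon) : nat :=
  match c with CIJ k | CJI k | CLR k | CLRT k => k end.

Definition canon_valid (c : canon) : Prop := (1 <= canon_size c)%N.

Definition canon_pair (c : canon) : mpair :=
  match c with
  | CIJ k => @MPair k k (@idm k) (@Jnil k)
  | CJI k => @MPair k k (@Jnil k) (@idm k)
  | CLR k => @MPair k.-1 k (@Lmat k) (@Rmat k)
  | CLRT k => @MPair k k.-1 (@LmatT k) (@RmatT k)
  end.

Definition canon_sum r (D : mat r r) (cs : list canon) : mpair :=
  dsum (@MPair r r (@idm r) D)
       (fold_right (fun c acc => dsum (canon_pair c) acc) empty_pair cs).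

End Matrices.
Arguments MPair {F} pm pn pA pB.
Arguments mulmv {F m n} A v i.
Arguments mulmm {F m n p} A B i k.
Arguments nonsingular {F r} D.
Arguments vdist {F n} x y.
Arguments continuous_map {F n n'} f.
Arguments homeomorphism {F n n'} f.
Arguments top_equiv {F} P Q.
Arguments top_similar {F r r'} D D'.
Arguments dsum_mat {F m n m' n'} A A' i j.
Arguments dsum {F} P Q.
Arguments canon_pair {F} c.
Arguments canon_sum {F r} D cs.
Arguments empty_pair {F}.

Arguments idm {F} k.
Arguments Jnil {F} k.
Arguments Lmat {F} k.
Arguments Rmat {F} k.
Arguments LmatT {F} k.
Arguments RmatT {F} k.

(* Main.v *)
(** Restricting (A, B) to B^-1(im A) -> im A is a reduction which shortens every block
    (J_k(0), I_k) and (L_k^T, R_k^T) by one and leaves the other canonical pairs unchanged.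
    A pair is determined up to linear equivalence by its size and its reduction, whence the
    existence of the decomposition, by induction on the size: as long as A or B is not
    bijective, the reduction is proper for the pair, for (B, A), or for one of their transposes.

    For uniqueness, the reduction only involves images and inverse images, so topologically
    equivalent pairs have topologically equivalent reductions, and the numbers of blocks are
    read off the dimensions along the successive reductions of (A, B) and (B, A). When only
    (I_r, D) and blocks (L_k, R_k) remain, A and B are onto and the dual reduction, to the
    quotients by ker A and B (ker A), is topologically invariant as well; it ends with
    (I_r, D), for which topological equivalence is topological similarity of D.

    This rests on the invariance of dimension. A homeomorphism h from R^n to R^m, m < n,
    would give maps from the cube of R^n to R^n which are close to the identity and Lipschitz
    as functions of h x. By a Sperner-type lemma on Kuhn's triangulation of the cube such
    maps nearly attain about q^n values at distance 1/q, while the points h x provide only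
    O(q^m) of them. *)
From Stdlib Require Import Reals List Permutation.
From HB Require Import structures.
From mathcomp Require Import all_boot all_order all_algebra.
From mathcomp Require Import fingroup perm.
From mathcomp Require Import boolp classical_sets reals topology normedtype Rstruct.
From mathcomp Require Import zify ring lra.
Require Import Defs.
Set Implicit Arguments.
Unset Strict Implicit.
Unset Printing Implicit Defensive.
Import Order.TTheory GRing.Theory Num.Theory numFieldNormedType.Exports.
Local Open Scope classical_set_scope.
Local Open Scope ring_scope.

(** * A Kuhn-Sperner lemma *)

Lemma row_cofactor_eq0 (R : comNzRingType) n (A : 'M[R]_n) (i1 i2 : 'I_n) :
  i1 != i2 -> \sum_j A i1 j * cofactor A i2 j = 0.
Proof.
move=> ne; transitivity ((A *m \adj A) i1 i2).
  by rewrite mxE; apply: eq_bigr => j _; rewrite mxE.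
by rewrite mul_mx_adj mxE (negPf ne).
Qed.

Lemma det_prop_rows (R : comNzRingType) n (A : 'M[R]_n) (i1 i2 : 'I_n) c :
  i1 != i2 -> (forall j, A i2 j = c * A i1 j) -> \det A = 0.
Proof.
move=> ne Ac; rewrite (expand_det_row _ i2).
rewrite (eq_bigr (fun j => c * (A i1 j * cofactor A i2 j))) => [|j _].
  by rewrite -mulr_sumr row_cofactor_eq0 ?mulr0.
by rewrite Ac mulrA.
Qed.

Section KuhnCells.
Variables n p : nat.

Local Notation pt := {ffun 'I_n.+1 -> nat}.
Local Notation base := {ffun 'I_n.+1 -> 'I_p.+1}.
Implicit Types (x : base) (s : 'S_n.+1) (u : 'I_n.+1 -> pt -> int).

(* The vertex reached after [j] steps, where [s i] is the time at which coordinate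
   [i] is incremented. *)
Definition kuhn_vertex x s (j : nat) : pt := [ffun i => (x i + (s i < j))%N].

(** Row 0 is constant 1 and the other rows are the labels, so for [n.+2] points the determinant is
    the signed volume of the simplex of labels, times [(n.+1)!]. *)
Definition kuhn_mx u m (f : 'I_m -> pt) : 'M[int]_(n.+2, m) :=
  \matrix_(a, j) oapp (fun k => u k (f j)) 1 (unlift ord0 a).

Definition kuhn_det u x s : int :=
  \det (kuhn_mx u (fun j : 'I_n.+2 => kuhn_vertex x s j)).

(** An analogue of the degree: up to a constant factor, the total signed volume of the images of all
    cells. It turns out to depend only on the boundary labels. *)
Definition kuhn_sum u : int :=
  \sum_(s : 'S_n.+1) \sum_(x : base) (-1) ^+ s * kuhn_det u x s.

Definition kuhn_labelling u : Prop :=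
  forall k (y : pt), (y k = 0%N -> u k y = 0) /\ (y k = p.+1 -> u k y = 1).

Lemma kuhn_mx0 u m (f : 'I_m -> pt) j : kuhn_mx u f ord0 j = 1.
Proof. by rewrite mxE unlift_none. Qed.

Lemma kuhn_mxS u m (f : 'I_m -> pt) k j : kuhn_mx u f (lift ord0 k) j = u k (f j).
Proof. by rewrite mxE liftK. Qed.

Lemma kuhn_det_const u x s k c :
  (forall j, (j <= n.+1)%N -> u k (kuhn_vertex x s j) = c) -> kuhn_det u x s = 0.
Proof.
move=> uc; apply: (@det_prop_rows _ _ _ ord0 (lift ord0 k) c) => //.
by move=> j; rewrite kuhn_mxS kuhn_mx0 mulr1 uc // -ltnS.
Qed.

Section Replace.
Variables (u u' : 'I_n.+1 -> pt -> int) (k0 : 'I_n.+1).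
Hypotheses (uP : kuhn_labelling u) (u'P : kuhn_labelling u').
Hypothesis uu' : forall k, k != k0 -> u k =1 u' k.

Let w (y : pt) : int := u k0 y - u' k0 y.
Let r : 'I_n.+2 := lift ord0 k0.

Definition face (j : 'I_n.+2) x s (i : 'I_n.+1) : pt := kuhn_vertex x s (lift j i).

(* A sum over a face only, so that it agrees on cells sharing that face. *)
Definition face_term (f : 'I_n.+1 -> pt) : int :=
  (\sum_i w (f i)) * \det (row' r (kuhn_mx u f)).

Lemma eq_face_term f g : f =1 g -> face_term f = face_term g.
Proof.
move=> fg; rewrite /face_term; congr (_ * _).
  by apply: eq_bigr => i _; rewrite fg.
congr (\det _); apply/matrixP=> a i; rewrite !mxE.
by case: unlift => //= k; rewrite fg.
Qed.

(** If [i0 = k0], both labellings prescribe the same value on the face, so [w] vanishes there.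
    Otherwise row [i0] survives the deletion of row [r] and is a multiple of the row of ones. *)
Lemma face_term_boundary (f : 'I_n.+1 -> pt) i0 c :
  (c = 0%N) \/ (c = p.+1) -> (forall i, f i i0 = c) -> face_term f = 0.
Proof.
move=> cP fc; rewrite /face_term; have [e|ne] := eqVneq i0 k0.
  rewrite big1 ?mul0r // => i _; rewrite /w -e.
  have [u0 u1] := uP i0 (f i); have [u0' u1'] := u'P i0 (f i).
  by case: cP => cE; [rewrite u0 ?u0' | rewrite u1 ?u1']; rewrite ?subrr ?fc.
have [a1 a1E _] := unlift_some (isT : r != ord0).
have neqi : r != lift ord0 i0 by rewrite (inj_eq lift_inj) eq_sym.
have [b0 b0E _] := unlift_some neqi.
rewrite (@det_prop_rows _ _ _ a1 b0 (c != 0%N)%:R) ?mulr0 //.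
  by apply: contraNneq (neq_lift ord0 i0) => eab; rewrite {1}a1E eab -b0E.
move=> j; rewrite mxE [X in _ = _ * X]mxE -a1E -b0E kuhn_mxS kuhn_mx0 mulr1.
have [u0 u1] := uP i0 (f j).
by case: cP => cE; [rewrite u0 | rewrite u1]; rewrite ?fc cE.
Qed.

(* Expand both determinants along row [r], where they have the same cofactors. These
   sum to 0 because of the row of ones, so the value of [w] at vertex [j] may be
   traded for minus its sum over the opposite face. *)
Lemma kuhn_det_replace x s :
  kuhn_det u x s - kuhn_det u' x s =
  - \sum_(j : 'I_n.+2) (-1) ^+ (r + j) * face_term (face j x s).
Proof.
set M := kuhn_mx u (fun j : 'I_n.+2 => kuhn_vertex x s j).
set M' := kuhn_mx u' (fun j : 'I_n.+2 => kuhn_vertex x s j).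
have cofE j : cofactor M' r j = cofactor M r j.
  rewrite /cofactor; congr (_ * _); congr (\det _); apply/matrixP=> a b.
  rewrite !mxE; case: unliftP => //= k ak; rewrite uu' //.
  apply: contraNneq (neq_lift r a) => kk0; rewrite ak /r kk0 //.
rewrite /kuhn_det (expand_det_row _ r) [X in _ - X](expand_det_row _ r).
rewrite -sumrB -sumrN.
have s0 : \sum_j cofactor M r j = 0.
  rewrite -[RHS](@row_cofactor_eq0 _ _ M ord0 r) //.
  by apply: eq_bigr => j _; rewrite kuhn_mx0 mul1r.
pose S := \sum_(j : 'I_n.+2) w (kuhn_vertex x s j).
transitivity (\sum_(j : 'I_n.+2) (w (kuhn_vertex x s j) - S) * cofactor M r j).
  under [RHS]eq_bigr do rewrite mulrBl; rewrite [RHS]sumrB -[X in _ = _ - X]mulr_sumr s0 mulr0 subr0.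
  by apply: eq_bigr => j _; rewrite -/M -/M' cofE -mulrBl !kuhn_mxS.
apply: eq_bigr => j _.
have -> : S = w (kuhn_vertex x s j) + \sum_i w (face j x s i).
  rewrite /S (bigD1 j) //=; congr (_ + _).
  rewrite (reindex (lift j)) /=; last first.
    exists (fun i => odflt ord0 (unlift j i)) => [i _|i]; first by rewrite liftK.
    by move=> /= ij; case: unliftP ij => [k ->|->] //; rewrite inE eqxx.
  by apply: eq_big => // i; rewrite eq_sym neq_lift.
rewrite opprD addrA subrr add0r mulNr; congr (- _).
rewrite /cofactor /face_term mulrCA; congr (_ * (_ * _)); congr (\det _).
by apply/matrixP=> a b; rewrite !mxE.
Qed.

(* Exchanging steps [j] and [j.+1] preserves the face and reverses the sign. *)
Lemma sum_inner_face (j : nat) (lt_j : (j.+1 < n.+1)%N) x :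
  \sum_(s : 'S_n.+1) (-1) ^+ s * face_term (face (inord j.+1) x s) = 0.
Proof.
have j1 : (j < n.+1)%N by apply: ltnW.
pose a := Ordinal j1; pose b := Ordinal lt_j.
have ab : a != b by rewrite -val_eqE /= neq_ltn ltnSn.
set S : int := LHS; suff : S = - S by move/eqP; rewrite -subr_eq0 opprK -mulr2n Num.Theory.mulrn_eq0 => /eqP.
rewrite {1}/S (reindex_inj (mulIg (tperm a b))) /= /S -sumrN.
apply: eq_bigr => s _; rewrite odd_permM odd_tperm ab addbT -mulNr.
congr (_ * _); first by case: (odd_perm s).
apply: eq_face_term => i; apply/ffunP=> k; rewrite !ffunE; congr (_ + nat_of_bool _)%N.
rewrite permM; set t := s k.
have : (lift (inord j.+1) i : nat) != j.+1.
  by rewrite -[X in _ != X](@inordK n.+1 j.+1) // eq_sym neq_lift.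
move: (nat_of_ord (lift _ _)) => l; rewrite permE /=.
move=> lj; case: eqP => [->|_] /=; last case: eqP => [->|_] /=; lia.
Qed.

(* The face of a cell opposite to its first vertex is the face opposite to the last
   vertex of the next cell in direction [i0]. Wrapping around modulo the number of
   cells is harmless, since boundary faces contribute 0. *)
Lemma sum_outer_faces :
  \sum_(s : 'S_n.+1) \sum_x (-1) ^+ s * face_term (face ord0 x s) =
  (-1) ^+ n * \sum_(s : 'S_n.+1) \sum_x (-1) ^+ s * face_term (face ord_max x s).
Proof.
(* Composing with [cyc] postpones the first increment, that of [i0] below, to the end; the signature
   of [cyc] is [(-1) ^+ n]. *)
pose cyc : 'S_n.+1 := lift_perm ord0 ord_max 1.
have cyc0 : cyc ord0 = ord_max by rewrite lift_perm_id.
have cycS (k : 'I_n) : (cyc (lift ord0 k) : nat) = k.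
  by rewrite lift_perm_lift perm1 lift_max.
rewrite [X in _ * X](reindex_inj (mulIg cyc)) /= mulr_sumr.
apply: eq_bigr => s _; rewrite mulr_sumr.
pose i0 := (s^-1)%g ord0; have si0 : s i0 = ord0 by rewrite permKV.
pose sh x : base := [ffun i => if i == i0 then ordS (x i) else x i].
have sh_inj : injective sh.
  move=> x y /ffunP exy; apply/ffunP=> i; move: (exy i); rewrite !ffunE.
  by case: ifP => // _; apply: (can_inj (@ordSK _)).
rewrite [RHS](reindex_inj sh_inj) /=; apply: eq_bigr => x _.
rewrite mulrA; congr (_ * _).
  rewrite odd_permM odd_lift_perm /= odd_perm1 addbF signr_addb signr_odd.
  by rewrite mulrCA -expr2 sqrr_sign mulr1.
have vE (j : nat) (i : 'I_n.+1) : ((s * cyc)%g i < j)%N = if i == i0 then (n < j)%N else (s i < j.+1)%N.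
  rewrite permM; case: eqP => [->|/eqP ne]; first by rewrite si0 cyc0.
  have : s i != ord0 by rewrite -si0 (inj_eq perm_inj).
  by rewrite eq_sym => /unlift_some[k -> _]; rewrite cycS lift0 ltnS.
have l0 (i : 'I_n.+1) : (lift (@ord0 n.+1) i : nat) = i.+1 by rewrite lift0.
have lm (i : 'I_n.+1) : (lift (@ord_max n.+1) i : nat) = i by rewrite lift_max.
have [e|ne] := eqVneq (x i0 : nat) p.
  rewrite (@face_term_boundary _ i0 p.+1); first last.
  - by move=> i; rewrite ffunE l0 si0 e addn1.
  - by right.
  rewrite (@face_term_boundary _ i0 0%N) //; first by left.
  move=> i; rewrite ffunE lm vE !ffunE eqxx /= e modnn add0n.
  by rewrite ltnNge -ltnS ltn_ord.
apply: eq_face_term => i; apply/ffunP=> k; rewrite !ffunE l0 lm vE.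
case: eqP => [->|//]; rewrite si0 /= modn_small; last first.
  by have := ltn_ord (x i0); rewrite ltnS leq_eqVlt (negPf ne).
by have := ltn_ord i; lia.
Qed.

(** Among the faces of all cells, the inner ones sum to 0 for each index, and by [sum_outer_faces]
    the contributions of the first and last indices cancel. *)
Lemma kuhn_sum_replace : kuhn_sum u = kuhn_sum u'.
Proof.
pose E (j : 'I_n.+2) : int :=
  \sum_(s : 'S_n.+1) \sum_x (-1) ^+ s * face_term (face j x s).
apply/eqP; rewrite -subr_eq0; apply/eqP.
transitivity (- \sum_(j : 'I_n.+2) (-1) ^+ (r + j) * E j).
  rewrite /kuhn_sum -sumrB -sumrN (eq_bigr _ (fun j _ => esym (mulNr _ _))).
  rewrite (eq_bigr _ (fun j _ => mulr_sumr _ _ _ _)) exchange_big.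
  apply: eq_bigr => s _.
  rewrite -sumrB (eq_bigr _ (fun j _ => mulr_sumr _ _ _ _)) exchange_big.
  apply: eq_bigr => x _; rewrite -mulrBr kuhn_det_replace mulrN mulr_sumr -sumrN.
  by apply: eq_bigr => j _; rewrite mulNr mulrCA.
rewrite big_ord_recl big_ord_recr big1 /= ?add0r => [|j _]; last first.
  rewrite [E _](_ : _ = 0) ?mulr0 // /E exchange_big big1 // => x _.
  have jj : (j.+1 < n.+1)%N by rewrite ltnS.
  rewrite -[RHS](sum_inner_face jj x); apply: eq_bigr => s _.
  by congr (_ * face_term (face _ _ _)); apply: val_inj; rewrite /= inordK // ltnW.
have -> : lift ord0 ord_max = ord_max :> 'I_n.+2 by apply: val_inj.
rewrite /E sum_outer_faces mulrA -mulrDl addn0 -exprD /bump /=.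
by rewrite [X in _ + _ ^+ X]addnCA [X in _ + X]exprD expr1 mulN1r subrr mul0r oppr0.
Qed.

End Replace.

(** The reference labelling: in direction [k] it is constant 1 on every cell with [x k != 0], so
    that only the cells at the corner 0 contribute. *)
Definition kuhn_std (k : 'I_n.+1) (y : pt) : int := (0 < y k)%N%:R.

Lemma kuhn_stdP : kuhn_labelling kuhn_std.
Proof. by move=> k y; rewrite /kuhn_std; split=> ->. Qed.

(** The label of vertex [j] in direction [k] is 1 exactly when [s k < j], so the matrix is
    unitriangular up to a permutation of its rows by [s], which accounts for the sign. *)
Lemma kuhn_std_cell s : (-1) ^+ s * kuhn_det kuhn_std [ffun=> ord0] s = 1.
Proof.
have lift_s (a : 'I_n.+2) : lift_perm ord0 ord0 s a = oapp (fun k => lift ord0 (s k)) ord0 (unlift ord0 a).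
  by case: unliftP => [k ->|->]; rewrite ?lift_perm_lift ?lift_perm_id.
pose U : 'M[int]_n.+2 := \matrix_(a, j) (a <= j)%N%:R.
have -> : kuhn_det kuhn_std [ffun=> ord0] s = \det (row_perm (lift_perm ord0 ord0 s) U).
  congr (\det _); apply/matrixP=> a j; rewrite !mxE lift_s.
  case: unliftP => [k _|_] //=.
  by rewrite /kuhn_std !ffunE /= add0n lt0b.
rewrite row_permE det_mulmx det_perm odd_lift_perm /= mulrA -expr2 sqrr_sign mul1r.
rewrite -det_tr det_trig.
  by rewrite big1 // => i _; rewrite !mxE leqnn.
by apply/is_trig_mxP => i j ij; rewrite !mxE leqNgt ij.
Qed.

Lemma kuhn_sum_std : kuhn_sum kuhn_std = #|{: 'S_n.+1}|%:R.
Proof.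
rewrite -sum1_card natr_sum; apply: eq_bigr => s _.
rewrite (bigD1 [ffun=> ord0]) //= kuhn_std_cell big1 ?addr0 // => x x0.
have [k xk] : exists k, x k != ord0.
  by apply/existsP; apply: contraNT x0; rewrite negb_exists => /forallP x0;
     apply/eqP/ffunP=> k; rewrite ffunE; apply/eqP; rewrite -[_ == _]negbK.
rewrite (@kuhn_det_const _ _ _ k 1) ?mulr0 // => j _.
rewrite /kuhn_std ffunE addn_gt0 lt0n (_ : (x k : nat) != 0%N) //.
Qed.

(** The labels are changed from [kuhn_std] to [u] one direction at a time. The sum keeps the value
    [(n.+1)!], so some determinant is nonzero, and none of its label rows is a multiple of the row
    of ones. *)
Theorem kuhn_cell u : kuhn_labelling u -> exists (x : base) (s : 'S_n.+1),
  forall k c, exists2 j, (j <= n.+1)%N & u k (kuhn_vertex x s j) != c.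
Proof.
move=> uP.
pose mix t (k : 'I_n.+1) := if (k < t)%N then u k else kuhn_std k.
have mixP t : kuhn_labelling (mix t).
  by move=> k y; rewrite /mix; case: ifP => _; [apply: uP|apply: kuhn_stdP].
have mixE t : (t <= n.+1)%N -> kuhn_sum (mix t) = kuhn_sum kuhn_std.
  elim: t => [//|t IH] lt_t; rewrite -IH; last exact: ltnW.
  apply: (@kuhn_sum_replace _ _ (Ordinal lt_t)) => // k.
  rewrite -val_eqE /= => kt y; rewrite /mix ltnS leq_eqVlt (negPf kt) //.
have : kuhn_sum u != 0.
  have -> : kuhn_sum u = kuhn_sum (mix n.+1).
    apply: eq_bigr => s _; apply: eq_bigr => x _; congr (_ * \det _).
    by apply/matrixP => a b; rewrite !mxE; case: unlift => //= k; rewrite /mix ltn_ord.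
  by rewrite mixE // kuhn_sum_std Num.Theory.pnatr_eq0 -lt0n; apply/card_gt0P; exists 1%g.
move=> sum0; apply: contrapT => H; case/eqP: sum0.
apply: big1 => s _; apply: big1 => x _.
have [->|d0] := eqVneq (kuhn_det u x s) 0; first by rewrite mulr0.
case: H; exists x, s => k c.
have [/forallP uc|] := boolP [forall j : 'I_n.+2, u k (kuhn_vertex x s j) == c].
  case/eqP: d0; apply: (@kuhn_det_const _ _ _ k c) => j j_le.
  by have /eqP := uc (Ordinal (j_le : (j < n.+2)%N)).
by rewrite negb_forall => /existsP[j uj]; exists j; rewrite // -ltnS.
Qed.

End KuhnCells.

(** * Invariance of dimension *)

Section InvarianceOfDimension.
Variable R : realType.

Definition coord_continuous n m (h : ('I_n -> R) -> ('I_m -> R)) : Prop :=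
  forall (x : 'I_n -> R) (e : R), 0 < e -> exists2 d : R, 0 < d &
    forall y, (forall i, `|y i - x i| < d) -> forall i, `|h y i - h x i| < e.

(** Heine's theorem on a cube, in a form where only [x] is confined to the cube. *)
Lemma coord_unif_continuous n m (h : ('I_n -> R) -> ('I_m -> R)) (M e : R) :
  coord_continuous h -> 0 < e -> exists2 d : R, 0 < d &
    forall x y, (forall i, `|x i| <= M) -> (forall i, `|y i - x i| < d) ->
      forall i, `|h y i - h x i| < e.
Proof.
move=> hc e0.
pose K : set 'rV[R]_n := [set v : 'rV[R]_n | forall i, `[- M, M]%classic (v ord0 i)].
have cK : compact K by apply: (@rV_compact _ n (fun=> `[- M, M]%classic)) => i; apply: segment_compact.
pose P (d : R) (v : 'rV[R]_n) := forall y : 'I_n -> R,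
  (forall i, `|y i - v ord0 i| < d) -> forall i, `|h y i - h (v ord0) i| < e.
have : \forall d \near 0^'+, K `<=` P d.
  apply: (iffLR (compact_near_coveringP K) cK) => v Kv.
  have [d d0 hd] := hc (v ord0) (e / 2) (divr_gt0 e0 (ltr0Sn _ _)).
  have d20 : 0 < d / 2 by apply: divr_gt0.
  exists (ball v (d / 2), [set r : R | r < d / 2]).
    by split => /=; [exact: nbhsx_ballx|exact: nbhs_right_lt].
  move=> [v' r] /= [[_ vv'] rd] y yv' i.
  have vd j : `|v' ord0 j - v ord0 j| < d / 2 by rewrite distrC; apply: vv'.
  have A1 : `|h y i - h (v ord0) i| < e / 2.
    apply: hd => j; have -> : y j - v ord0 j = (y j - v' ord0 j) + (v' ord0 j - v ord0 j) by ring.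
    apply: le_lt_trans (ler_normD _ _) _.
    by rewrite [ltRHS]splitr ltrD // (lt_trans (yv' j)).
  have A2 : `|h (v' ord0) i - h (v ord0) i| < e / 2.
    by apply: hd => j; apply: lt_trans (vd j) _; lra.
  have -> : h y i - h (v' ord0) i = (h y i - h (v ord0) i) - (h (v' ord0) i - h (v ord0) i) by ring.
  by apply: le_lt_trans (ler_normB _ _) _; rewrite [ltRHS]splitr ltrD.
move=> /nbhs_ballP[r /= r0 hr]; exists (r / 2); first exact: divr_gt0.
move=> x y xM yx i.
have rb : ball 0 r (r / 2) by rewrite /ball /= sub0r normrN gtr0_norm; lra.
have KR : K (\row_j x j) by move=> j /=; rewrite mxE in_itv /= -ler_norml.
have rowE : (\row_j x j) ord0 = x by apply/funext => j; rewrite mxE.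
have := hr _ rb (divr_gt0 r0 (ltr0Sn _ _)) _ KR y; rewrite rowE; exact.
Qed.

Lemma coord_bounded n m (h : ('I_n -> R) -> ('I_m -> R)) (M : R) :
  coord_continuous h -> exists2 B : R, 0 < B &
    forall x, (forall i, `|x i| <= M) -> forall i, `|h x i| <= B.
Proof.
move=> hc.
pose K : set 'rV[R]_n := [set v : 'rV[R]_n | forall i, `[- M, M]%classic (v ord0 i)].
have cK : compact K.
  by apply: (@rV_compact _ n (fun=> `[- M, M]%classic)) => i; apply: segment_compact.
pose P (B : R) (v : 'rV[R]_n) := forall i, `|h (v ord0) i| <= B.
have : \forall B \near +oo, K `<=` P B.
  apply: (iffLR (compact_near_coveringP K) cK) => v Kv.
  have [d d0 hd] := hc (v ord0) 1 ltr01.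
  pose b := 1 + \sum_i `|h (v ord0) i|.
  exists (ball v d, [set r : R | b < r]).
    by split => /=; [exact: nbhsx_ballx|apply: nbhs_pinfty_gt; exact: num_real].
  move=> [v' r] /= [[_ vv'] br] i; apply/ltW/(le_lt_trans _ br).
  rewrite -[h _ i](subrK (h (v ord0) i)) (le_trans (ler_normD _ _)) // lerD //.
    by apply/ltW/hd => j; rewrite distrC; apply: vv'.
  by rewrite (bigD1 i) //= lerDl sumr_ge0.
move=> /pinfty_ex_gt0[B B0 KB]; exists B => // x xM i.
have := KB (\row_j x j) _ i; rewrite (_ : (\row_j x j) ord0 = x); last first.
  by apply/funext => j; rewrite mxE.
by apply=> j /=; rewrite mxE in_itv /= -ler_norml.
Qed.

(** A discrete Poincare-Miranda theorem. Points are labelled by whether [F k] exceeds [c k]; in the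
    cell given by [kuhn_cell] every [F k] has values on both sides of [c k], and they differ by at
    most [e] from its value at the first vertex. *)
Lemma grid_crossing n p (F : 'I_n.+1 -> {ffun 'I_n.+1 -> nat} -> R)
    (c : 'I_n.+1 -> R) (e : R) :
    (forall k (y : {ffun 'I_n.+1 -> nat}), (forall i, y i <= p.+1)%N -> y k = 0%N -> F k y <= c k) ->
    (forall k (y : {ffun 'I_n.+1 -> nat}), (forall i, y i <= p.+1)%N -> y k = p.+1 -> c k < F k y) ->
    (forall k (y y' : {ffun 'I_n.+1 -> nat}), (forall i, y i <= y' i <= (y i).+1)%N ->
       (forall i, y' i <= p.+1)%N -> `|F k y - F k y'| <= e) ->
  exists2 y : {ffun 'I_n.+1 -> nat}, (forall i, y i <= p.+1)%N &
    forall k, `|F k y - c k| <= e.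
Proof.
move=> F0 F1 Fe.
(* A labelling is defined on all points with natural coordinates, whereas [F] is controlled on the
   grid only. *)
pose clip (y : {ffun 'I_n.+1 -> nat}) := [ffun i => minn (y i) p.+1].
have clip_le y i : (clip y i <= p.+1)%N by rewrite ffunE geq_minr.
pose u (k : 'I_n.+1) (y : {ffun 'I_n.+1 -> nat}) : int := (c k < F k (clip y))%R%:R.
have [|x [s xs]] := @kuhn_cell n p u.
  move=> k y; rewrite /u; split=> yk.
    by rewrite ltNge F0 // ffunE yk.
  by rewrite F1 // ffunE yk minnn.
exists (clip (kuhn_vertex x s 0)) => // k.
have [j _ uj] := xs k (u k (kuhn_vertex x s 0)).
have := Fe k (clip (kuhn_vertex x s 0)) (clip (kuhn_vertex x s j)).
move: uj; rewrite /u.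
set a := F k _; set b := F k _ => uj ab.
have {ab} : `|b - a| <= e.
  apply: ab => // i; rewrite !ffunE ltn0; have := ltn_ord (x i).
  by case: (s i < j)%N => /=; lia.
move: uj; have [ca|ca] := ltP (c k) a; have [cb|cb] := ltP (c k) b => // _.
  by rewrite !ler_norml; lra.
by rewrite !ler_norml; lra.
Qed.

Definition sup_dist m (a b : 'I_m -> R) : R := \big[Num.max/0]_i `|a i - b i|.

Lemma sup_dist_le m (a b : 'I_m -> R) e :
  0 <= e -> (sup_dist a b <= e) = [forall i, `|a i - b i| <= e].
Proof.
move=> e0; apply/idP/forallP => [ab i|ab]; first exact: le_trans (le_bigmax _ _ _) ab.
by apply: bigmax_le.
Qed.

Lemma sup_dist_ge0 m (a b : 'I_m -> R) : 0 <= sup_dist a b.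
Proof. exact: bigmax_ge_id. Qed.

Lemma sup_distxx m (a : 'I_m -> R) : sup_dist a a = 0.
Proof.
apply: le_anti; rewrite sup_dist_ge0 sup_dist_le // andbT.
by apply/forallP => i; rewrite subrr normr0.
Qed.

Lemma ler_sup_dist m (a b : 'I_m -> R) i : `|a i - b i| <= sup_dist a b.
Proof. exact: le_bigmax. Qed.

Lemma sup_distC m (a b : 'I_m -> R) : sup_dist a b = sup_dist b a.
Proof. by apply: eq_bigr => i _; rewrite distrC. Qed.

Lemma sup_dist_triangle m (a b c : 'I_m -> R) :
  sup_dist a c <= sup_dist a b + sup_dist b c.
Proof.
rewrite sup_dist_le ?addr_ge0 ?sup_dist_ge0 //; apply/forallP => i.
by rewrite (le_trans (ler_distD (b i) _ _)) // lerD // ler_sup_dist.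
Qed.

Section LipschitzApproximation.
Variables (n m p : nat) (h : ('I_n -> R) -> ('I_m -> R)) (L : R).
Hypothesis L0 : 0 <= L.

Definition grid_pt (y : {ffun 'I_n -> nat}) : 'I_n -> R :=
  fun i => (y i)%:R / p.+1%:R.

(* When [h] has a uniformly continuous inverse and [L] is large, this inf-convolution
   is uniformly close to the coordinate [k], but is [L]-Lipschitz as a function of
   [h a]. The default value 2 exceeds all coordinates of points of the unit cube. *)
Definition lip_approx (k : 'I_n) (a : 'I_n -> R) : R :=
  \big[Num.min/2]_(z : {ffun 'I_n -> 'I_p.+2})
    (grid_pt [ffun i => z i : nat] k
     + L * sup_dist (h a) (h (grid_pt [ffun i => z i : nat]))).

Lemma lip_approx_le k (y : {ffun 'I_n -> nat}) :
  (forall i, y i <= p.+1)%N -> lip_approx k (grid_pt y) <= grid_pt y k.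
Proof.
move=> yp; apply: le_trans (bigmin_le _ [ffun i => inord (y i)] _) _.
rewrite (_ : [ffun i => _] = y) ?sup_distxx ?mulr0 ?addr0 //.
by apply/ffunP => i; rewrite !ffunE inordK // ltnS.
Qed.

Lemma lip_approx_lip k a b :
  lip_approx k a <= lip_approx k b + L * sup_dist (h a) (h b).
Proof.
rewrite -lerBlDr; apply: le_bigmin => [|z _].
  rewrite lerBlDr (le_trans (bigmin_le_id _ _ _ _)) // lerDl.
  by rewrite mulr_ge0 // sup_dist_ge0.
rewrite lerBlDr (le_trans (bigmin_le _ z _)) // -addrA lerD2l -mulrDr.
by rewrite ler_wpM2l // addrC sup_dist_triangle.
Qed.

Lemma grid_pt_bounds (y : {ffun 'I_n -> nat}) i :
  (y i <= p.+1)%N -> 0 <= grid_pt y i <= 1.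
Proof.
move=> yp; rewrite divr_ge0 ?ler0n //= ler_pdivrMr ?ltr0n // mul1r.
by rewrite ler_nat.
Qed.

(** A point with [L * sup_dist (h a) (h b) >= 1] contributes at least 1, hence at least [a k]; the
    others are covered by the hypothesis, and the default value 2 is large enough. *)
Lemma lip_approx_ge k a e : a k <= 1 -> 0 <= e ->
    (forall b, (forall i, 0 <= b i <= 1) -> L * sup_dist (h a) (h b) < 1 ->
       a k - e <= b k) ->
  a k - e <= lip_approx k a.
Proof.
move=> a1 e0 ab; apply: le_bigmin => [|z _]; first lra.
set b := grid_pt _.
have b01 i : 0 <= b i <= 1.
  by apply: grid_pt_bounds; rewrite ffunE -ltnS ltn_ord.
have /andP[bk0 _] := b01 k.
have L1 : 0 <= L * sup_dist (h a) (h b) by rewrite mulr_ge0 // sup_dist_ge0.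
have [lt1|ge1] := ltP (L * sup_dist (h a) (h b)) 1; last lra.
by rewrite (le_trans (ab _ b01 lt1)) // lerDl.
Qed.

End LipschitzApproximation.

Lemma natr_dist_lt1 (a b : nat) : `|a%:R - b%:R| < 1 :> R -> a = b.
Proof. by rewrite ltr_norml ltrNl opprB !ltrBlDr -!(natrD _ 1) !ltr_nat; lia. Qed.

Lemma natr_dist_succ (a b : nat) : (a <= b <= a.+1)%N -> `|b%:R - a%:R| <= 1 :> R.
Proof.
by move=> ab; rewrite ler_norml lerNl opprB !lerBlDr -!(natrD _ 1) !ler_nat; lia.
Qed.

Theorem embedding_dimension n m
    (h : ('I_n -> R) -> ('I_m -> R)) (g : ('I_m -> R) -> ('I_n -> R)) :
  coord_continuous h -> coord_continuous g -> cancel h g -> (n <= m)%N.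
Proof.
move=> hc gc hK; case: n h g hc gc hK => [//|n] h g hc gc hK.
rewrite leqNgt; apply/negP => lt_mn.
have cube_norm (b : 'I_n.+1 -> R) : (forall i, 0 <= b i <= 1) -> forall i, `|b i| <= 1.
  by move=> b01 i; rewrite ler_norml; have := b01 i; lra.
have [M M0 hM] := coord_bounded 1 hc.
(* With tolerance 1/8, [F k] is at least 7/8 on the face where coordinate [k] is 1, while all
   targets stay below 1/2. *)
have e8 : (0 : R) < 8^-1 by rewrite invr_gt0.
have [d d0 gd] := coord_unif_continuous M gc e8.
(* The interval [[-M, M]] will be cut into pieces of length [s / (4 * L) = d / (8 * q)], that is
   [16 * M / d * q] of them, fewer than [C * q]. The choice of [q] makes [(C * q) ^ m] smaller than
   [q ^ m.+1]. *)
pose B := (Num.truncn (16 * M / d)).+1; pose C := B.+1.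
have BM : 16 * M / d < B%:R by apply: truncnS_gt.
pose q := (C ^ m).+1.
(* With this [L], the condition [L * sup_dist < 1] in [lip_approx_ge] says that the images are
   [d]-close, so the points themselves are within 1/8 by the choice of [d]. *)
pose L := d^-1; have L0 : 0 <= L by rewrite invr_ge0 ltW.
pose s : R := (2 * q%:R)^-1.
have q0 : (0 : R) < q%:R by rewrite ltr0n.
have s0 : 0 < s by rewrite invr_gt0 mulr_gt0.
(* Images of adjacent grid points will be within [s * d / 4], hence the values of [F k] within
   [L * (s * d / 4) = s / 4]. *)
have e1 : 0 < s * d / 4 by rewrite !mulr_gt0 // invr_gt0.
have [t t0 ht] := coord_unif_continuous 1 hc e1.
pose p := Num.truncn t^-1.
have pt : p.+1%:R^-1 < t.
  by rewrite invf_plt ?posrE ?ltr0n // truncnS_gt.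
pose F k (y : {ffun 'I_n.+1 -> nat}) := lip_approx p h L k (grid_pt p y).
have grid01 (y : {ffun 'I_n.+1 -> nat}) : (forall i, y i <= p.+1)%N -> forall i, 0 <= grid_pt p y i <= 1.
  by move=> yp i; apply: grid_pt_bounds.
have Fge k (y : {ffun 'I_n.+1 -> nat}) : (forall i, y i <= p.+1)%N -> grid_pt p y k - 8^-1 <= F k y.
  move=> yp; have y01 := grid01 y yp.
  apply: (@lip_approx_ge _ _ p h L L0 k (grid_pt p y) _ _ (ltW e8)) => [|b b01 hyb]; first by case/andP: (y01 k).
  have hd i : `|h b i - h (grid_pt p y) i| < d.
    rewrite distrC (le_lt_trans (ler_sup_dist _ _ _)) //.
    by move: hyb; rewrite /L mulrC ltr_pdivrMr ?mul1r.
  have := gd _ _ (hM _ (cube_norm _ y01)) hd k; rewrite !hK ltr_norml; lra.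
have FL k (y y' : {ffun 'I_n.+1 -> nat}) : F k y - F k y' <= L * sup_dist (h (grid_pt p y)) (h (grid_pt p y')).
  by rewrite lerBlDl lip_approx_lip.
have FLn k (y y' : {ffun 'I_n.+1 -> nat}) : `|F k y - F k y'| <= L * sup_dist (h (grid_pt p y)) (h (grid_pt p y')).
  by rewrite ler_norml FL andbT lerNl opprB sup_distC FL.
pose c (j : {ffun 'I_n.+1 -> 'I_q}) k : R := (j k)%:R * s.
have cross j : exists2 y : {ffun 'I_n.+1 -> nat}, (forall i, y i <= p.+1)%N &
    forall k, `|F k y - c j k| <= s / 4.
  apply: grid_crossing => [k y yp y0|k y yp y1|k y y' yy' y'p].
  - apply: le_trans (lip_approx_le _ L _ yp) _.
    by rewrite /grid_pt y0 mul0r mulr_ge0 // ltW.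
  - apply: lt_le_trans (Fge _ _ yp); rewrite /grid_pt y1 divff ?pnatr_eq0 //.
    apply: (@lt_trans _ _ (2^-1 : R)); last lra.
    by rewrite /c /s invfM mulrCA gtr_pMr ?invr_gt0 // ltr_pdivrMr // mul1r ltr_nat ltn_ord.
  - have yp i : (y i <= p.+1)%N by case/andP: (yy' i) => yy'i _; apply: leq_trans (y'p i).
    apply: le_trans (FLn _ _ _) _.
    have -> : s / 4 = L * (s * d / 4) by rewrite /L; field; rewrite gt_eqF.
    rewrite ler_wpM2l // sup_dist_le; last exact: ltW.
    apply/forallP => i; rewrite distrC; apply/ltW/ht.
      by apply: cube_norm; apply: grid01.
    move=> {}i; apply: le_lt_trans pt; rewrite /grid_pt -mulrBl.
    by rewrite normrM (@ger0_norm _ p.+1%:R^-1) ?invr_ge0 ?ler0n // ler_piMl ?invr_ge0 ?ler0n // natr_dist_succ.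
(* The q^(n+1) target points [c j] are almost attained at grid points [Y j], whose
   images under [h] lie in distinct cells of an m-dimensional grid with O(q^m) cells. *)
have [Y Y1 Y2] : exists2 Y : {ffun 'I_n.+1 -> 'I_q} -> {ffun 'I_n.+1 -> nat},
    forall j i, (Y j i <= p.+1)%N & forall j k, `|F k (Y j) - c j k| <= s / 4.
  have [Y YP] := choice (fun j => let: ex_intro2 y y1 y2 := cross j in ex_intro _ y (conj y1 y2)).
  by exists Y => j; case: (YP j).
pose w := s / (4 * L).
have Lp : 0 < L by rewrite invr_gt0.
have w0 : 0 < w by rewrite divr_gt0 // mulr_gt0.
pose H j := h (grid_pt p (Y j)).
have HM j i : `|H j i| <= M.
  by apply: hM; apply: cube_norm; apply: grid01.
have wE : w^-1 = 8 * q%:R / d by rewrite /w /s /L; field; rewrite !gt_eqF.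
have pos j i : 0 <= (H j i + M) / w.
  by apply: divr_ge0; [have := HM j i; rewrite ler_norml; lra|exact: ltW].
have bnd j i : (Num.truncn ((H j i + M) / w) < C * q)%N.
  rewrite truncn_lt_nat //; apply: (@le_lt_trans _ _ (16 * M / d * q%:R)).
    rewrite wE (_ : 16 * M / d * q%:R = (2 * M) * (8 * q%:R / d)); last first.
      by field; rewrite gt_eqF.
    apply: ler_wpM2r; first by rewrite mulr_ge0 ?invr_ge0 ?mulr_ge0 // ltW.
    by have := HM j i; rewrite ler_norml; lra.
  by rewrite natrM ltr_pM2r // (lt_trans BM) // ltr_nat.
pose code (j : {ffun 'I_n.+1 -> 'I_q}) : {ffun 'I_m -> 'I_(C * q)} :=
  [ffun i => Ordinal (bnd j i)].
have code_inj : injective code.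
  move=> j j' jj'; apply/ffunP => k; apply: val_inj => /=.
  have HH : sup_dist (H j) (H j') <= w.
    rewrite sup_dist_le; last exact: ltW.
    apply/forallP => i; have := congr1 (fun f : {ffun 'I_m -> 'I_(C * q)} => val (f i)) jj'; rewrite !ffunE /= => tE.
    have /andP[a1 a2] := truncn_itv (pos j i); have /andP[b1 b2] := truncn_itv (pos j' i).
    rewrite tE ler_pdivlMr // in a1; rewrite tE ltr_pdivrMr // -natr1 mulrDl mul1r in a2.
    rewrite ler_pdivlMr // in b1; rewrite ltr_pdivrMr // -natr1 mulrDl mul1r in b2.
    by rewrite ler_norml; lra.
  have FF : `|F k (Y j) - F k (Y j')| <= s / 4.
    apply: le_trans (FLn _ _ _) _; apply: le_trans (ler_wpM2l L0 HH) _.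
    by rewrite /w le_eqVlt; apply/orP; left; apply/eqP; field; rewrite gt_eqF.
  (* Each target is within [s / 4] of its value of [F k], and the two values are within [s / 4];
     targets less than [s] apart in a coordinate agree there. *)
  have cc : `|c j k - c j' k| < s.
    have := Y2 j k; have := Y2 j' k; move: FF; rewrite !ler_norml ltr_norml; lra.
  by move: cc; rewrite /c -mulrBl normrM (gtr0_norm s0) gtr_pMl //; apply: natr_dist_lt1.
have := leq_card code code_inj.
rewrite !card_ffun !card_ord; apply/negP; rewrite -ltnNge expnMn.
apply: (@leq_trans (q ^ m.+1)); last by rewrite leq_pexp2l.
by rewrite expnS ltn_pmul2r // expn_gt0.
Qed.

End InvarianceOfDimension.

(** * Reduction of matrix pairs *)

Definition diag_rel := fun i j : nat => i == j.
Definition sub_rel := fun i j : nat => i == j.+1.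
Definition super_rel := fun i j : nat => i.+1 == j.

Ltac rel_lia := rewrite /diag_rel /sub_rel /super_rel; intros; lia.

Section Pencils.
Variable K : fieldType.

(** The sizes of the two pairs are not assumed equal, so invertibility is expressed by rectangular
    two-sided inverses. *)
Definition lin_equiv m n (A B : 'M[K]_(m, n)) m' n' (A' B' : 'M[K]_(m', n')) : Prop :=
  exists (S : 'M[K]_(n', n)) (S' : 'M[K]_(n, n')) (T : 'M[K]_(m', m)) (T' : 'M[K]_(m, m')),
  [/\ S' *m S = 1%:M, S *m S' = 1%:M, T' *m T = 1%:M & T *m T' = 1%:M] /\
  T *m A = A' *m S /\ T *m B = B' *m S.

Lemma lin_equiv_refl m n (A B : 'M[K]_(m, n)) : lin_equiv A B A B.
Proof.
by exists 1%:M, 1%:M, 1%:M, 1%:M; rewrite !mulmx1 !mul1mx.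
Qed.

Lemma lin_equiv_sym m n (A B : 'M[K]_(m, n)) m' n' (A' B' : 'M[K]_(m', n')) :
  lin_equiv A B A' B' -> lin_equiv A' B' A B.
Proof.
move=> [S [S' [T [T' [[e1 e2 e3 e4] [eA eB]]]]]]; exists S', S, T', T; split=> //.
by split; [rewrite -[A]mul1mx -e3 -(mulmxA T') eA | rewrite -[B]mul1mx -e3 -(mulmxA T') eB];
   rewrite -!mulmxA e2 mulmx1.
Qed.

Lemma lin_equiv_trans m n (A B : 'M[K]_(m, n)) m' n' (A' B' : 'M[K]_(m', n'))
    m2 n2 (A2 B2 : 'M[K]_(m2, n2)) :
  lin_equiv A B A' B' -> lin_equiv A' B' A2 B2 -> lin_equiv A B A2 B2.
Proof.
move=> [S [S' [T [T' [[e1 e2 e3 e4] [eA eB]]]]]].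
move=> [U [U' [V [V' [[f1 f2 f3 f4] [fA fB]]]]]].
exists (U *m S), (S' *m U'), (V *m T), (T' *m V'); split; last first.
  by rewrite -!mulmxA eA eB !mulmxA fA fB.
split.
- by rewrite mulmxA -(mulmxA S') f1 mulmx1 e1.
- by rewrite mulmxA -(mulmxA U) e2 mulmx1 f2.
- by rewrite mulmxA -(mulmxA T') f3 mulmx1 e3.
- by rewrite mulmxA -(mulmxA V) e4 mulmx1 f4.
Qed.

Lemma lin_equiv_swap m n (A B : 'M[K]_(m, n)) m' n' (A' B' : 'M[K]_(m', n')) :
  lin_equiv A B A' B' -> lin_equiv B A B' A'.
Proof. by move=> [S [S' [T [T' [e [eA eB]]]]]]; exists S, S', T, T'. Qed.

Lemma lin_equiv_tr m n (A B : 'M[K]_(m, n)) m' n' (A' B' : 'M[K]_(m', n')) :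
  lin_equiv A B A' B' -> lin_equiv A^T B^T A'^T B'^T.
Proof.
move=> /lin_equiv_sym[S [S' [T [T' [[e1 e2 e3 e4] [eA eB]]]]]].
exists T^T, T'^T, S^T, S'^T; rewrite -!trmx_mul e1 e2 e3 e4 eA eB.
by rewrite !trmx1.
Qed.

Definition diag2 m n (A : 'M[K]_(m, n)) m' n' (A' : 'M[K]_(m', n')) :=
  block_mx A 0 0 A'.

Lemma diag2M m n p (A : 'M[K]_(m, n)) (B : 'M[K]_(n, p))
    m' n' p' (A' : 'M[K]_(m', n')) (B' : 'M[K]_(n', p')) :
  diag2 A A' *m diag2 B B' = diag2 (A *m B) (A' *m B').
Proof. by rewrite mulmx_block !mulmx0 !mul0mx !addr0 add0r. Qed.

Lemma diag2_1 m n : diag2 1%:M 1%:M = 1%:M :> 'M[K]_(m + n).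
Proof. by rewrite /diag2 -scalar_mx_block. Qed.

Lemma diag2_0 m n m' n' : diag2 0 0 = 0 :> 'M[K]_(m + m', n + n').
Proof. exact: block_mx0. Qed.

Lemma diag2D m n (A B : 'M[K]_(m, n)) m' n' (A' B' : 'M[K]_(m', n')) :
  diag2 A A' + diag2 B B' = diag2 (A + B) (A' + B').
Proof. by rewrite add_block_mx !addr0. Qed.

Lemma tr_diag2 m n (A : 'M[K]_(m, n)) m' n' (A' : 'M[K]_(m', n')) :
  (diag2 A A')^T = diag2 A^T A'^T.
Proof. by rewrite tr_block_mx !trmx0. Qed.

Lemma lin_equiv_diag2 m n (A B : 'M[K]_(m, n)) m' n' (A' B' : 'M[K]_(m', n'))
    p q (C D : 'M[K]_(p, q)) p' q' (C' D' : 'M[K]_(p', q')) :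
  lin_equiv A B A' B' -> lin_equiv C D C' D' ->
  lin_equiv (diag2 A C) (diag2 B D) (diag2 A' C') (diag2 B' D').
Proof.
move=> [S [S' [T [T' [[e1 e2 e3 e4] [eA eB]]]]]].
move=> [U [U' [V [V' [[f1 f2 f3 f4] [fA fB]]]]]].
exists (diag2 S U), (diag2 S' U'), (diag2 T V), (diag2 T' V').
by rewrite !diag2M e1 e2 e3 e4 f1 f2 f3 f4 eA eB fA fB !diag2_1.
Qed.

Lemma lin_equiv_diag2_0r m n (A B : 'M[K]_(m, n)) (C D : 'M[K]_(0, 0)) :
  lin_equiv (diag2 A C) (diag2 B D) A B.
Proof.
have cr p : col_mx 1%:M 0 *m row_mx 1%:M 0 = 1%:M :> 'M[K]_(p + 0).
  rewrite mul_col_row !mulmx1 mulmx0 mul0mx -(diag2_1 p 0) /diag2.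
  by congr block_mx; apply/matrixP => [[]] //; rewrite ?mulmx0.
have rc p : row_mx 1%:M 0 *m col_mx 1%:M 0 = 1%:M :> 'M[K]_p.
  by rewrite mul_row_col mulmx1 mulmx0 addr0.
exists (row_mx 1%:M 0), (col_mx 1%:M 0), (row_mx 1%:M 0), (col_mx 1%:M 0).
split; first by rewrite !cr !rc.
by rewrite !mul_row_block !mul_mx_row !mul1mx !mul0mx !mulmx1 !mulmx0 !addr0.
Qed.

(* [(A1, B1)] is the restriction of [(A, B)] to [B^-1(im A) -> im A]; [I] and [J] are
   the inclusions, with left inverses [I'] and [J']. The equations with [X] and [Y]
   say that [im J = im A], those with [Z] that [im I] contains [B^-1(im A)]. *)
Definition reduction m n (A B : 'M[K]_(m, n)) m1 n1 (A1 B1 : 'M[K]_(m1, n1)) : Prop :=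
  exists (I : 'M[K]_(n, n1)) (I' : 'M[K]_(n1, n)) (J : 'M[K]_(m, m1)) (J' : 'M[K]_(m1, m))
         (X : 'M[K]_(m1, n)) (Y : 'M[K]_(n, m1)) (Z : 'M[K]_(n, m)),
  [/\ I' *m I = 1%:M, J' *m J = 1%:M, A *m I = J *m A1 & B *m I = J *m B1] /\
  [/\ A = J *m X, J = A *m Y, 1%:M = I *m I' + Z *m B & Z *m A = 0].

Lemma reduction_diag2 m n (A B : 'M[K]_(m, n)) m1 n1 (A1 B1 : 'M[K]_(m1, n1))
    p q (C D : 'M[K]_(p, q)) p1 q1 (C1 D1 : 'M[K]_(p1, q1)) :
  reduction A B A1 B1 -> reduction C D C1 D1 ->
  reduction (diag2 A C) (diag2 B D) (diag2 A1 C1) (diag2 B1 D1).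
Proof.
move=> [I [I' [J [J' [X [Y [Z [[e1 e2 e3 e4] [e5 e6 e7 e8]]]]]]]]].
move=> [I2 [I2' [J2 [J2' [X2 [Y2 [Z2 [[f1 f2 f3 f4] [f5 f6 f7 f8]]]]]]]]].
exists (diag2 I I2), (diag2 I' I2'), (diag2 J J2), (diag2 J' J2'),
  (diag2 X X2), (diag2 Y Y2), (diag2 Z Z2).
rewrite !diag2M !diag2D e1 e2 e3 e4 -e5 -e6 -e7 e8.
by rewrite f1 f2 f3 f4 -f5 -f6 -f7 f8 !diag2_1 diag2_0.
Qed.

(** When [A] is onto, im A and B^-1(im A) are the whole spaces. *)
Lemma reduction_id m n (A B : 'M[K]_(m, n)) (Y : 'M[K]_(n, m)) :
  A *m Y = 1%:M -> reduction A B A B.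
Proof.
move=> AY; exists 1%:M, 1%:M, 1%:M, 1%:M, A, Y, 0.
by rewrite !mulmx1 !mul1mx !mul0mx addr0.
Qed.

Definition rel_mx (P : nat -> nat -> bool) m n : 'M[K]_(m, n) :=
  \matrix_(i, j) (P i j)%:R.

(** Each entry of the product has at most one nonzero term, at the intermediate index [w i l];
    products of shifts thus become arithmetic on indices. *)
Lemma rel_mxM m n p (w : nat -> nat -> nat) (P Q R : nat -> nat -> bool) :
  (forall i j l, i < m -> j < n -> l < p -> P i j -> Q j l -> R i l /\ j = w i l)%N ->
  (forall i l, i < m -> l < p -> R i l -> [&& w i l < n, P i (w i l) & Q (w i l) l])%N ->
  rel_mx P m n *m rel_mx Q n p = rel_mx R m p.
Proof.
move=> PQ Rw; apply/matrixP => i l; rewrite !mxE.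
have [Ril|nR] := boolP (R i l).
  have /and3P[wn Pw Qw] := Rw i l (ltn_ord i) (ltn_ord l) Ril.
  rewrite (bigD1 (Ordinal wn)) //= !mxE Pw Qw mulr1 big1 ?addr0 // => j.
  rewrite !mxE -val_eqE /= => jw.
  case Pj: (P i j); last by rewrite mul0r.
  case Qj: (Q j l); last by rewrite mulr0.
  have [_ e] := PQ _ _ _ (ltn_ord i) (ltn_ord j) (ltn_ord l) Pj Qj.
  by rewrite e eqxx in jw.
rewrite big1 // => j _; rewrite !mxE.
case Pj: (P i j); last by rewrite mul0r.
case Qj: (Q j l); last by rewrite mulr0.
have [R1 _] := PQ _ _ _ (ltn_ord i) (ltn_ord j) (ltn_ord l) Pj Qj.
by rewrite R1 in nR.
Qed.

Lemma rel_mx1 n : rel_mx (fun i j => i == j) n n = 1%:M.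
Proof. by apply/matrixP=> i j; rewrite !mxE. Qed.

Lemma tr_diag_rel m n : (rel_mx diag_rel m n)^T = rel_mx diag_rel n m.
Proof. by apply/matrixP=> i j; rewrite !mxE /diag_rel eq_sym. Qed.

Lemma tr_sub_rel m n : (rel_mx sub_rel m n)^T = rel_mx super_rel n m.
Proof. by apply/matrixP=> i j; rewrite !mxE /super_rel eq_sym. Qed.

Lemma tr_super_rel m n : (rel_mx super_rel m n)^T = rel_mx sub_rel n m.
Proof. by apply/matrixP=> i j; rewrite !mxE /sub_rel eq_sym. Qed.

(** The image of the Jordan block is spanned by all basis vectors but the first. As B is the
    identity, the same shift is the inclusion on both sides. *)
Lemma reduction_JI k :
  reduction (rel_mx sub_rel k.+1 k.+1) 1%:M (rel_mx sub_rel k k) 1%:M.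
Proof.
have e1 : rel_mx super_rel k k.+1 *m rel_mx sub_rel k.+1 k = 1%:M.
  by rewrite -rel_mx1; apply: (@rel_mxM _ _ _ (fun i l => i.+1)); rel_lia.
have e2 : rel_mx sub_rel k.+1 k *m rel_mx diag_rel k k.+1 = rel_mx sub_rel k.+1 k.+1.
  by apply: (@rel_mxM _ _ _ (fun i l => i.-1)); rel_lia.
exists (rel_mx sub_rel k.+1 k), (rel_mx super_rel k k.+1), (rel_mx sub_rel k.+1 k), (rel_mx super_rel k k.+1),
  (rel_mx diag_rel k k.+1), (rel_mx diag_rel k.+1 k),
  (1%:M - rel_mx sub_rel k.+1 k *m rel_mx super_rel k k.+1).
split; split; rewrite ?mulmx1 ?mul1mx ?subrKC ?e1 ?e2 //.
- rewrite (@rel_mxM _ _ _ (fun i l => l.+1) _ _ (fun i l => i == l.+2)).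
  + by rewrite (@rel_mxM _ _ _ (fun i l => l.+1) _ _ (fun i l => i == l.+2)) //; rel_lia.
  + rel_lia.
  + rel_lia.
- by rewrite (@rel_mxM _ _ _ (fun i l => l) _ _ sub_rel) //; rel_lia.
- by rewrite -e2 mulmxA mulmxBl mul1mx -mulmxA e1 mulmx1 subrr mul0mx.
Qed.

(** The image of the first matrix is spanned by the first [k] basis vectors, and the second, a shift
    by one, maps only the first [k.-1] basis vectors into it. For [k = 0] a pair of size 1 by 0
    becomes empty. *)
Lemma reduction_LRT k :
  reduction (rel_mx diag_rel k.+1 k) (rel_mx sub_rel k.+1 k) (rel_mx diag_rel k k.-1) (rel_mx sub_rel k k.-1).
Proof.
have e1 : rel_mx diag_rel k k.+1 *m rel_mx diag_rel k.+1 k = 1%:M.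
  by rewrite -rel_mx1; apply: (@rel_mxM _ _ _ (fun i l => i)); rel_lia.
have e2 : rel_mx diag_rel k.-1 k *m rel_mx diag_rel k k.-1 = 1%:M.
  by rewrite -rel_mx1; apply: (@rel_mxM _ _ _ (fun i l => i)); rel_lia.
have e3 : rel_mx super_rel k k.+1 *m rel_mx sub_rel k.+1 k = 1%:M.
  by rewrite -rel_mx1; apply: (@rel_mxM _ _ _ (fun i l => i.+1)); rel_lia.
exists (rel_mx diag_rel k k.-1), (rel_mx diag_rel k.-1 k), (rel_mx diag_rel k.+1 k), (rel_mx diag_rel k k.+1),
  1%:M, 1%:M, ((1%:M - rel_mx diag_rel k k.-1 *m rel_mx diag_rel k.-1 k) *m rel_mx super_rel k k.+1).
split; split; rewrite ?mulmx1 ?mul1mx ?e1 ?e2 //.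
- rewrite (@rel_mxM _ _ _ (fun i l => l) _ _ sub_rel) ?(@rel_mxM _ _ _ (fun i l => i) _ _ sub_rel) //;
  rel_lia.
- by rewrite -mulmxA e3 mulmx1 subrKC.
- rewrite -mulmxA (@rel_mxM _ _ _ (fun i l => l) super_rel diag_rel super_rel); last 2 first.
  + rel_lia.
  + rel_lia.
  rewrite mulmxBl mul1mx -mulmxA (@rel_mxM _ _ _ (fun i l => i) diag_rel super_rel super_rel); last 2 first.
  + rel_lia.
  + rel_lia.
  rewrite (@rel_mxM _ _ _ (fun i l => i) diag_rel super_rel super_rel) ?subrr //.
  + rel_lia.
  + rel_lia.
Qed.

(** * Splitting of idempotents, kernels and complements *)

Lemma rank_factorization m n (A : 'M[K]_(m, n)) :
  exists (C : 'M[K]_(m, \rank A)) (C' : 'M[K]_(\rank A, m))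
         (R : 'M[K]_(\rank A, n)) (R' : 'M[K]_(n, \rank A)),
  [/\ A = C *m R, C' *m C = 1%:M & R *m R' = 1%:M].
Proof.
have /row_fullP[C' CK] := col_base_full A; have /row_freeP[R' RK] := row_base_free A.
by exists (col_base A), C', (row_base A), R'; rewrite mulmx_base.
Qed.

(** Cancelling the outer factors of a rank factorization [E = U *m U'] in [E *m E = E] leaves
    [U' *m U = 1%:M]. *)
Lemma idempotent_split n (E : 'M[K]_n) : E *m E = E ->
  exists b (U : 'M[K]_(n, b)) (U' : 'M[K]_(b, n)), E = U *m U' /\ U' *m U = 1%:M.
Proof.
move: (\rank E) (rank_factorization E) => r [U [C [U' [D [-> CK DK]]]]] EE.
exists r, U, U'; split=> //; move: EE => /(congr1 (fun M => C *m M *m D)).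
by rewrite !mulmxA CK !mul1mx -(mulmxA _ U' D) DK mulmx1.
Qed.

Lemma left_inverse_complement n n1 (I : 'M[K]_(n, n1)) (I' : 'M[K]_(n1, n)) :
  I' *m I = 1%:M -> exists b (U : 'M[K]_(n, b)) (U' : 'M[K]_(b, n)),
  n = (n1 + b)%N /\
  [/\ U' *m U = 1%:M, I' *m U = 0, U' *m I = 0 & 1%:M = I *m I' + U *m U'].
Proof.
move=> I1; have [|b [U [U' [EU U1]]]] := @idempotent_split _ (1%:M - I *m I').
  by rewrite mulmxBl !mul1mx mulmxBr mulmx1 -mulmxA (mulmxA I') I1 mul1mx subrr subr0.
have IU : I' *m U = 0.
  by rewrite -[U]mulmx1 -U1 (mulmxA U) -EU mulmxBl mul1mx -(mulmxA I) mulmxBr !mulmxA I1 mul1mx subrr.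
have UI : U' *m I = 0.
  by rewrite -[U']mul1mx -U1 -(mulmxA U') -EU -mulmxA mulmxBl mul1mx -(mulmxA I) I1 mulmx1 subrr mulmx0.
have E1 : 1%:M = I *m I' + U *m U' by rewrite -EU addrC subrK.
exists b, U, U'; split; last by [].
have e1 : row_mx I U *m col_mx I' U' = 1%:M by rewrite mul_row_col -E1.
have e2 : col_mx I' U' *m row_mx I U = 1%:M.
  by rewrite mul_col_row I1 U1 IU UI -scalar_mx_block.
by apply/eqP; rewrite eqn_leq (mulmx1_min e1) (mulmx1_min e2).
Qed.

Lemma kernel_split m n (N : 'M[K]_(m, n)) :
  exists n1 (I : 'M[K]_(n, n1)) (I' : 'M[K]_(n1, n)) (G : 'M[K]_(n, m)),
  [/\ I' *m I = 1%:M, N *m I = 0 & 1%:M = I *m I' + G *m N].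
Proof.
move: (\rank N) (rank_factorization N) => r [C [Q [R [P [NE QK PK]]]]].
have QN : Q *m N = R by rewrite NE mulmxA QK mul1mx.
have [|b [I [I' [EI I1]]]] := @idempotent_split _ (1%:M - P *m R).
  by rewrite mulmxBl !mul1mx mulmxBr mulmx1 -mulmxA (mulmxA R) PK mul1mx subrr subr0.
exists b, I, I', (P *m Q); split=> //; last by rewrite -EI -mulmxA QN subrK.
rewrite -[I]mulmx1 -I1 (mulmxA I) -EI mulmxBl mul1mx mulmxBr NE.
by rewrite -!mulmxA (mulmxA R P) PK mul1mx subrr.
Qed.

(** [G] carries the image of [Z1] to that of [Z2], and a complement of the former to one of the
    latter; the complements have equal dimensions. *)
Lemma left_inverse_transport c b (Z1 Z2 : 'M[K]_(c, b)) (L1 L2 : 'M[K]_(b, c)) :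
  L1 *m Z1 = 1%:M -> L2 *m Z2 = 1%:M ->
  exists G G' : 'M[K]_c, [/\ G' *m G = 1%:M, G *m G' = 1%:M & G *m Z1 = Z2].
Proof.
move=> LZ1 LZ2.
have [b1 [H1 [H1' [e1 [f1 f2 f3 f4]]]]] := left_inverse_complement LZ1.
have [b2 [H2 [H2' [e2 [g1 g2 g3 g4]]]]] := left_inverse_complement LZ2.
have eb : b2 = b1 by apply: (@addnI b); rewrite -e1 -e2.
subst b2.
have GG : (Z1 *m L2 + H1 *m H2') *m (Z2 *m L1 + H2 *m H1') = 1%:M.
  rewrite mulmxDl !mulmxDr -!mulmxA !(mulmxA L2) !(mulmxA H2') LZ2 g1 g2 g3.
  by rewrite !mul0mx !mul1mx !mulmx0 addr0 add0r -f4.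
exists (Z2 *m L1 + H2 *m H1'), (Z1 *m L2 + H1 *m H2'); split=> //.
  exact: mulmx1C.
by rewrite mulmxDl -!mulmxA LZ1 f3 mulmx1 mulmx0 addr0.
Qed.

Lemma right_inverse_transport t b (Z1 Z2 : 'M[K]_(t, b)) (L1 L2 : 'M[K]_(b, t)) :
  Z1 *m L1 = 1%:M -> Z2 *m L2 = 1%:M ->
  exists G G' : 'M[K]_b, [/\ G' *m G = 1%:M, G *m G' = 1%:M & Z1 *m G = Z2].
Proof.
move=> /(congr1 trmx) + /(congr1 trmx); rewrite !trmx_mul !trmx1 => LZ1 LZ2.
have [G [G' [e1 e2 e3]]] := left_inverse_transport LZ1 LZ2.
exists G^T, G'^T; rewrite -!trmx_mul e1 e2 trmx1; split=> //.
by apply: trmx_inj; rewrite trmx_mul trmxK.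
Qed.

(** * Existence, size and uniqueness properties of the reduction *)

Lemma reduction_exists m n (A B : 'M[K]_(m, n)) :
  exists n1 (A1 B1 : 'M[K]_(\rank A, n1)), reduction A B A1 B1.
Proof.
move: (\rank A) (rank_factorization A) => r [J [J' [X [Y0 [/esym JX JK YK]]]]].
(* Since [J *m J'] projects onto im A, the kernel taken here is B^-1(im A). *)
have [n1 [I [I' [G [e1 e2 e3]]]]] := kernel_split ((1%:M - J *m J') *m B).
exists n1, (J' *m A *m I), (J' *m B *m I), I, I', J, J', X, Y0, (G *m (1%:M - J *m J')).
have JA : J *m (J' *m A) = A by rewrite -JX (mulmxA J') JK mul1mx.
split; split=> //.
- by rewrite mulmxA JA.
- by apply/eqP; rewrite -subr_eq0 -e2 -!mulmxA mulmxBl mul1mx !mulmxA.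
- by rewrite -JX -mulmxA YK mulmx1.
- by rewrite -mulmxA.
- by rewrite -mulmxA mulmxBl mul1mx -mulmxA JA subrr mulmx0.
Qed.

Lemma reduction_lin_equiv m n (A B : 'M[K]_(m, n)) m1 n1 (A1 B1 : 'M[K]_(m1, n1))
    m2 n2 (A2 B2 : 'M[K]_(m2, n2)) :
  reduction A B A1 B1 -> lin_equiv A1 B1 A2 B2 -> reduction A B A2 B2.
Proof.
move=> [I [I' [J [J' [X [Y [Z [[e1 e2 e3 e4] [e5 e6 e7 e8]]]]]]]]].
move=> /lin_equiv_sym[S' [S [T' [T [[f1 f2 f3 f4] [fA fB]]]]]].
exists (I *m S'), (S *m I'), (J *m T'), (T *m J'), (T *m X), (Y *m T'), Z.
split; split=> //.
- by rewrite mulmxA -(mulmxA S) e1 mulmx1.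
- by rewrite mulmxA -(mulmxA T) e2 mulmx1.
- by rewrite mulmxA e3 -!mulmxA fA.
- by rewrite mulmxA e4 -!mulmxA fB.
- by rewrite mulmxA -(mulmxA J) f4 mulmx1.
- by rewrite mulmxA -e6.
- by rewrite mulmxA -(mulmxA I) f2 mulmx1.
Qed.

Lemma reduction_rank m n (A B : 'M[K]_(m, n)) m1 n1 (A1 B1 : 'M[K]_(m1, n1)) :
  reduction A B A1 B1 -> \rank A = m1.
Proof.
move=> [I [I' [J [J' [X [Y [Z [[_ e2 _ _] [e5 e6 _ _]]]]]]]]].
apply/eqP; rewrite eqn_leq; apply/andP; split.
  by rewrite e5 (leq_trans (mxrankM_maxl _ _)) // rank_leq_col.
by apply: (@mulmx1_min_rank _ _ _ _ _ J' Y); rewrite -mulmxA -e6.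
Qed.

(** [B] induces an injection between the quotients by the images of [I] and [J], whence [b <= c].
    The last bound holds because [A] maps onto the image of [J] and [A1] is its restriction to a
    subspace of codimension [b]. *)
Lemma reduction_size m n (A B : 'M[K]_(m, n)) m1 n1 (A1 B1 : 'M[K]_(m1, n1)) :
  reduction A B A1 B1 ->
  exists b c, [/\ n = n1 + b, m = m1 + c, b <= c & m1 <= \rank A1 + b]%N.
Proof.
move=> [I [I' [J [J' [X [Y [Z [[e1 e2 e3 e4] [e5 e6 e7 e8]]]]]]]]].
have [b [U [U' [nb [f1 f2 f3 f4]]]]] := left_inverse_complement e1.
have [c [H [H' [mc [g1 g2 g3 g4]]]]] := left_inverse_complement e2.
exists b, c; split=> //.
  have ZJ : Z *m J = 0 by rewrite e6 mulmxA e8 mul0mx.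
  apply: (@mulmx1_min _ _ _ (U' *m Z *m H) (H' *m B *m U)).
  have ZB : Z *m B *m U = U.
    by rewrite -[RHS]mul1mx e7 mulmxDl -[I *m I' *m U]mulmxA f2 mulmx0 add0r.
  rewrite -{}f1 -[in RHS]ZB -[B in RHS]mul1mx g4 mulmxDl mulmxDr !mulmxA ZJ !mul0mx add0r.
  by rewrite !mulmxA.
have XI : X *m I = A1 by rewrite -[LHS]mul1mx -e2 -mulmxA (mulmxA J) -e5 e3 mulmxA e2 mul1mx.
have XY : X *m Y = 1%:M by rewrite -e2 [in RHS]e6 [in RHS]e5 -(mulmxA J) (mulmxA J') e2 mul1mx.
have rX : (m1 <= \rank X)%N by have := mxrankM_maxl X Y; rewrite XY mxrank1.
apply: leq_trans rX _.
rewrite -[X]mulmx1 f4 mulmxDr !mulmxA XI.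
apply: leq_trans (mxrank_add _ _) _; apply: leq_add; first exact: mxrankM_maxl.
by apply: leq_trans (mxrankM_maxl _ _) _; apply: rank_leq_col.
Qed.

Lemma eq_on_split n n1 b p (I : 'M[K]_(n, n1)) I' (U : 'M[K]_(n, b)) U' (M N : 'M[K]_(p, n)) :
  1%:M = I *m I' + U *m U' -> M *m I = N *m I -> M *m U = N *m U -> M = N.
Proof.
by move=> e eI eU; rewrite -[M]mulmx1 -[N]mulmx1 e !mulmxDr !mulmxA eI eU.
Qed.

Lemma reduction_unique m n (A B A' B' : 'M[K]_(m, n)) m1 n1 (A1 B1 : 'M[K]_(m1, n1)) :
  reduction A B A1 B1 -> reduction A' B' A1 B1 -> lin_equiv A B A' B'.
Proof.
(* In bases adapted to [I, U] and [J, H], both pairs have the form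
   [A1 X; 0 0], [B1 *; 0 Z] with [A1 X] of full row rank and [Z] of full column rank. *)
move=> [I [I' [J [J' [X [Y [Z [[I1 J1 AI BI] [AX JY IZ ZA]]]]]]]]].
move=> [i [i' [j [j' [x [y [z [[i1 j1 A'i B'i] [A'x jy iz zA]]]]]]]]].
have [b [U [U' [nb [U1 I'U U'I V1]]]]] := left_inverse_complement I1.
have [c [H [H' [mc [H1 J'H H'J W1]]]]] := left_inverse_complement J1.
have [b2 [u [u' [nb2 [u1 i'u u'i v1]]]]] := left_inverse_complement i1.
have [c2 [h [h' [mc2 [h1 j'h h'j w1]]]]] := left_inverse_complement j1.
have eb : b2 = b by apply: (@addnI n1); rewrite -nb.
have ec : c2 = c by apply: (@addnI m1); rewrite -mc.
subst b2 c2; move=> {nb nb2 mc mc2}.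
have XI : X *m I = A1 by rewrite -[LHS]mul1mx -J1 -mulmxA (mulmxA J) -AX AI mulmxA J1 mul1mx.
have xi : x *m i = A1 by rewrite -[LHS]mul1mx -j1 -mulmxA (mulmxA j) -A'x A'i mulmxA j1 mul1mx.
have XY : X *m Y = 1%:M by rewrite -J1 [in RHS]JY [in RHS]AX -(mulmxA J) (mulmxA J') J1 mul1mx.
have xy : x *m y = 1%:M by rewrite -j1 [in RHS]jy [in RHS]A'x -(mulmxA j) (mulmxA j') j1 mul1mx.
have ZJ : Z *m J = 0 by rewrite JY mulmxA ZA mul0mx.
have zj : z *m j = 0 by rewrite jy mulmxA zA mul0mx.
have ZBU : Z *m B *m U = U.
  by rewrite -[RHS]mul1mx IZ mulmxDl -[I *m I' *m U]mulmxA I'U mulmx0 add0r.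
have zbu : z *m B' *m u = u.
  by rewrite -[RHS]mul1mx iz mulmxDl -[i *m i' *m u]mulmxA i'u mulmx0 add0r.
pose Zu := H' *m B *m U; pose zu := h' *m B' *m u.
have BU : B *m U = J *m (J' *m B *m U) + H *m Zu.
  by rewrite /Zu !mulmxA -!mulmxDl -W1 mul1mx.
have bu : B' *m u = j *m (j' *m B' *m u) + h *m zu.
  by rewrite /zu !mulmxA -!mulmxDl -w1 mul1mx.
have ZuL : (U' *m Z *m H) *m Zu = 1%:M.
  rewrite -U1 -[in RHS]ZBU -(mulmxA Z) BU mulmxDr (mulmxA Z) ZJ mul0mx add0r.
  by rewrite !mulmxA.
have zuL : (u' *m z *m h) *m zu = 1%:M.
  rewrite -u1 -[in RHS]zbu -(mulmxA z) bu mulmxDr (mulmxA z) zj mul0mx add0r.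
  by rewrite !mulmxA.
(* The matrix [L] below projects onto the cokernel of [A1]. As [X] is onto and [X *m I = A1], the
   complement [U] alone maps onto this cokernel. *)
have [t [L0 [L0' [G0 [L1 AL LG]]]]] := kernel_split A1^T.
pose L := L0^T; pose L' := L0'^T; pose G := G0^T.
have LL : L *m L' = 1%:M by rewrite -trmx_mul L1 trmx1.
have LA : L *m A1 = 0 by rewrite -[A1]trmxK -trmx_mul AL trmx0.
have L'L : 1%:M = L' *m L + A1 *m G.
  by have := congr1 trmx LG; rewrite trmx1 linearD /= !trmx_mul trmxK.
have LX : (L *m X *m U) *m (U' *m Y *m L') = 1%:M.
  have -> : L *m X *m U *m (U' *m Y *m L') = L *m (X *m (U *m U')) *m Y *m L' by rewrite !mulmxA.
  have -> : U *m U' = 1%:M - I *m I' by rewrite V1 addrC addKr.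
  by rewrite mulmxBr mulmx1 (mulmxA X) XI mulmxBr !mulmxA LA !mul0mx subr0 -(mulmxA L) XY mulmx1.
have Lx : (L *m x *m u) *m (u' *m y *m L') = 1%:M.
  have -> : L *m x *m u *m (u' *m y *m L') = L *m (x *m (u *m u')) *m y *m L' by rewrite !mulmxA.
  have -> : u *m u' = 1%:M - i *m i' by rewrite v1 addrC addKr.
  by rewrite mulmxBr mulmx1 (mulmxA x) xi mulmxBr !mulmxA LA !mul0mx subr0 -(mulmxA L) xy mulmx1.
(* [P] matches the two complements modulo im A1; the remaining difference lies in im A1 and is
   corrected by [T]. *)
have [P [P' [P'P PP' LP]]] := right_inverse_transport Lx LX.
pose T := G *m (X *m U - x *m u *m P).
have XU : X *m U = x *m u *m P + A1 *m T.
  apply/eqP; rewrite addrC -subr_eq; apply/eqP.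
  rewrite -[LHS]mul1mx L'L mulmxDl -[L' *m L *m _]mulmxA mulmxBr !mulmxA LP subrr mulmx0 add0r.
  by rewrite -mulmxA.
have zuPL : (P' *m (u' *m z *m h)) *m (zu *m P) = 1%:M.
  by rewrite mulmxA -(mulmxA P') zuL mulmx1.
(* [Q] matches the injective lower blocks of [B] and [B']. The discrepancy [N] of the upper blocks
   is absorbed by [V] through the left inverse [R] of [Zu]. *)
have [Q [Q' [Q'Q QQ' QZ]]] := left_inverse_transport ZuL zuPL.
pose N := j' *m B' *m u *m P + B1 *m T - J' *m B *m U.
pose R := U' *m Z *m H; have RZ : R *m Zu = 1%:M by [].
have NE : J' *m B *m U + N = j' *m B' *m u *m P + B1 *m T by rewrite /N addrC subrK.
clearbody R N T Zu zu.
pose S := i *m I' + (u *m P + i *m T) *m U'.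
pose S' := I *m i' + (U *m P' - I *m T *m P') *m u'.
pose V := j *m J' + (j *m N *m R + h *m Q) *m H'.
pose V' := J *m j' + (H *m Q' - J *m N *m R *m Q') *m h'.
have SI : S *m I = i by rewrite /S mulmxDl -!mulmxA I1 U'I !mulmx0 mulmx1 addr0.
have SU : S *m U = u *m P + i *m T by rewrite /S mulmxDl -!mulmxA I'U U1 !mulmx0 mulmx1 add0r.
have VJ : V *m J = j by rewrite /V mulmxDl -!mulmxA J1 H'J !mulmx0 mulmx1 addr0.
have VH : V *m H = j *m N *m R + h *m Q.
  by rewrite /V mulmxDl -!mulmxA J'H H1 !mulmx0 !mulmx1 add0r !mulmxA.
have SS : S' *m S = 1%:M.
  apply: (eq_on_split V1); rewrite -mulmxA ?SI ?SU mul1mx.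
    by rewrite /S' mulmxDl -!mulmxA i1 u'i !mulmx0 mulmx1 addr0.
  have e1 : i' *m (u *m P + i *m T) = T by rewrite mulmxDr !mulmxA i'u i1 mul0mx mul1mx add0r.
  have e2 : u' *m (u *m P + i *m T) = P by rewrite mulmxDr !mulmxA u1 u'i mul0mx mul1mx addr0.
  rewrite /S' mulmxDl -!(mulmxA _ _ (u *m P + i *m T)) e1 e2 mulmxBl.
  by rewrite -!mulmxA P'P !mulmx1 addrC subrK.
have VV : V' *m V = 1%:M.
  apply: (eq_on_split W1); rewrite -mulmxA ?VJ ?VH mul1mx.
    by rewrite /V' mulmxDl -!mulmxA j1 h'j !mulmx0 mulmx1 addr0.
  have e1 : j' *m (j *m N *m R + h *m Q) = N *m R by rewrite mulmxDr !mulmxA j'h j1 mul0mx mul1mx addr0.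
  have e2 : h' *m (j *m N *m R + h *m Q) = Q by rewrite mulmxDr !mulmxA h1 h'j !mul0mx mul1mx add0r.
  rewrite /V' mulmxDl -!(mulmxA _ _ (j *m N *m R + h *m Q)) e1 e2 mulmxBl.
  by rewrite -!mulmxA Q'Q !mulmx1 addrC subrK.
exists S, S', V, V'; split; first by rewrite SS VV (mulmx1C SS) (mulmx1C VV).
split; apply: (eq_on_split V1).
- by rewrite -!mulmxA SI AI (mulmxA V) VJ A'i.
- by rewrite -!mulmxA SU {1}AX -(mulmxA J) (mulmxA V) VJ XU !mulmxDr !mulmxA A'i {1}A'x.
- by rewrite -!mulmxA SI BI (mulmxA V) VJ B'i.
rewrite -!mulmxA SU BU mulmxDr !(mulmxA V) VJ VH mulmxDl -!mulmxA RZ QZ mulmx1.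
rewrite mulmxDr !(mulmxA B') bu B'i mulmxDl -!mulmxA.
rewrite addrA -mulmxDr addrAC -mulmxDr; congr (j *m _ + _).
by rewrite !mulmxA NE.
Qed.

End Pencils.

(** * Canonical forms *)

Section Canonical.
Variables (K : fieldType) (dist : K -> K -> R).
Definition field_scalars : scalars := @Scalars K +%R *%R 0 1 dist.
Local Notation S := field_scalars.
Local Notation pm := (@Defs.pm S).
Local Notation pn := (@Defs.pn S).
Local Notation pA := (@Defs.pA S).
Local Notation pB := (@Defs.pB S).

(** * Translation of pairs and canonical blocks into matrices *)

Definition mx_of m n (A : mat S m n) : 'M[K]_(m, n) := \matrix_(i, j) A i j.
Definition mat_of m n (A : 'M[K]_(m, n)) : mat S m n := fun i j => A i j.

Lemma mat_ofK m n (A : 'M[K]_(m, n)) : mx_of (mat_of A) = A.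
Proof. by apply/matrixP=> i j; rewrite mxE. Qed.

Lemma mx_ofK m n (A : mat S m n) : mat_of (mx_of A) = A.
Proof. by apply/funext => i; apply/funext => j; rewrite /mat_of mxE. Qed.

Lemma mx_of_mul m n p (A : mat S m n) (B : mat S n p) :
  mx_of (mulmm A B) = mx_of A *m mx_of B.
Proof. by apply/matrixP=> i j; rewrite !mxE; apply: eq_bigr => k _; rewrite !mxE. Qed.

Lemma mx_of_dsum m n m' n' (A : mat S m n) (A' : mat S m' n') :
  mx_of (dsum_mat A A') = diag2 (mx_of A) (mx_of A').
Proof.
apply/matrixP=> i j; rewrite !mxE /dsum_mat.
by case: split => a; rewrite !mxE; case: split => b; rewrite !mxE.
Qed.

Lemma mx_of_id k : mx_of (@idm S k) = 1%:M.
Proof. by apply/matrixP=> i j; rewrite !mxE /idm -val_eqE; case: eqP. Qed.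

Lemma mx_of_J k : mx_of (@Jnil S k) = rel_mx K sub_rel k k.
Proof. by apply/matrixP=> i j; rewrite !mxE /Jnil /sub_rel; case: eqP. Qed.

Lemma mx_of_L k : mx_of (@Lmat S k) = rel_mx K diag_rel k.-1 k.
Proof. by apply/matrixP=> i j; rewrite !mxE /Lmat /diag_rel; case: eqP. Qed.

Lemma mx_of_R k : mx_of (@Rmat S k) = rel_mx K super_rel k.-1 k.
Proof. by apply/matrixP=> i j; rewrite !mxE /Rmat /super_rel eq_sym; case: eqP. Qed.

Lemma mx_of_LT k : mx_of (@LmatT S k) = rel_mx K diag_rel k k.-1.
Proof. by apply/matrixP=> i j; rewrite !mxE /LmatT /Lmat /diag_rel eq_sym; case: eqP. Qed.

Lemma mx_of_RT k : mx_of (@RmatT S k) = rel_mx K sub_rel k k.-1.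
Proof. by apply/matrixP=> i j; rewrite !mxE /RmatT /Rmat /sub_rel; case: eqP. Qed.

Definition mx_ofE := (mx_of_id, mx_of_J, mx_of_L, mx_of_R, mx_of_LT, mx_of_RT).

Lemma nonsingularP r (D : mat S r r) :
  nonsingular D <-> exists E, mx_of D *m E = 1%:M /\ E *m mx_of D = 1%:M.
Proof.
split=> [[E [DE ED]]|[E [DE ED]]].
  by exists (mx_of E); rewrite -!mx_of_mul DE ED mx_of_id.
exists (mat_of E); split; rewrite -[LHS]mx_ofK -[RHS]mx_ofK mx_of_id mx_of_mul mat_ofK.
  by rewrite DE.
by rewrite ED.
Qed.

Definition pair_equiv (P Q : mpair S) : Prop :=
  lin_equiv (mx_of (pA P)) (mx_of (pB P)) (mx_of (pA Q)) (mx_of (pB Q)).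
Definition pair_reduction (P Q : mpair S) : Prop :=
  reduction (mx_of (pA P)) (mx_of (pB P)) (mx_of (pA Q)) (mx_of (pB Q)).
Definition pair_swap (P : mpair S) : mpair S := MPair _ _ (pB P) (pA P).
Definition pair_tr (P : mpair S) : mpair S :=
  MPair _ _ (mat_of (mx_of (pA P))^T) (mat_of (mx_of (pB P))^T).

Lemma pair_equiv_dsum P Q P' Q' : pair_equiv P P' -> pair_equiv Q Q' -> pair_equiv (dsum P Q) (dsum P' Q').
Proof. by rewrite /pair_equiv !mx_of_dsum; apply: lin_equiv_diag2. Qed.

Lemma pair_reduction_dsum P Q P' Q' : pair_reduction P P' -> pair_reduction Q Q' -> pair_reduction (dsum P Q) (dsum P' Q').
Proof. by rewrite /pair_reduction !mx_of_dsum; apply: reduction_diag2. Qed.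

Definition canon_tail (cs : seq canon) : mpair S :=
  fold_right (fun c acc => dsum (canon_pair c) acc) empty_pair cs.

Lemma canon_sumE r (D : mat S r r) cs :
  canon_sum D cs = dsum (MPair r r (idm r) D) (canon_tail cs).
Proof. by []. Qed.

Lemma pm_canon_sum r (D : mat S r r) cs : pm (canon_sum D cs) = (r + pm (canon_tail cs))%N.
Proof. by []. Qed.

Lemma pn_canon_sum r (D : mat S r r) cs : pn (canon_sum D cs) = (r + pn (canon_tail cs))%N.
Proof. by []. Qed.

Definition swap_canon c := match c with CIJ k => CJI k | CJI k => CIJ k | c => c end.
Definition tr_canon c := match c with CLR k => CLRT k | CLRT k => CLR k | c => c end.

(** Reversal of the basis, which exchanges L_k with R_k and J_k(0) with its transpose. *)
Definition rev_mx n : 'M[K]_n := rel_mx K (fun i j => i + j.+1 == n)%N n n.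

Lemma rev_mxK n : rev_mx n *m rev_mx n = 1%:M.
Proof.
by rewrite -rel_mx1; apply: (@rel_mxM _ _ _ _ (fun i l => n - i.+1)%N); intros; lia.
Qed.

Lemma lin_equiv_swap_LR k :
  lin_equiv (rel_mx K super_rel k.-1 k) (rel_mx K diag_rel k.-1 k)
            (rel_mx K diag_rel k.-1 k) (rel_mx K super_rel k.-1 k).
Proof.
exists (rev_mx k), (rev_mx k), (rev_mx k.-1), (rev_mx k.-1).
rewrite !rev_mxK; split=> //; split.
  rewrite (@rel_mxM _ _ _ _ (fun i l => l.-1) _ _ (fun i l => i + l.+1 == k)%N).
  - rewrite (@rel_mxM _ _ _ _ (fun i l => i) _ _ (fun i l => i + l.+1 == k)%N) //;
    rel_lia.
  - rel_lia.
  - rel_lia.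
rewrite (@rel_mxM _ _ _ _ (fun i l => l) _ _ (fun i l => i + l.+2 == k)%N).
- rewrite (@rel_mxM _ _ _ _ (fun i l => i.+1) _ _ (fun i l => i + l.+2 == k)%N) //;
  rel_lia.
- rel_lia.
- rel_lia.
Qed.

Lemma lin_equiv_tr_J k :
  lin_equiv 1%:M (rel_mx K sub_rel k k)^T 1%:M (rel_mx K sub_rel k k).
Proof.
exists (rev_mx k), (rev_mx k), (rev_mx k), (rev_mx k).
rewrite !rev_mxK mul1mx mulmx1 tr_sub_rel; split=> //; split=> //.
rewrite (@rel_mxM _ _ _ _ (fun i l => l.-1) _ _ (fun i l => i + l == k)%N).
- rewrite (@rel_mxM _ _ _ _ (fun i l => i.-1) _ _ (fun i l => i + l == k)%N) //;
  rel_lia.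
- rel_lia.
- rel_lia.
Qed.

Lemma pair_equiv_swap_canon c : pair_equiv (pair_swap (canon_pair c)) (canon_pair (swap_canon c)).
Proof.
case: c => k; rewrite /pair_equiv /= !mx_ofE; try exact: lin_equiv_refl.
  exact: lin_equiv_swap_LR.
by have := lin_equiv_tr (lin_equiv_swap_LR k); rewrite !tr_diag_rel !tr_super_rel.
Qed.

Lemma pair_equiv_tr_canon c : pair_equiv (pair_tr (canon_pair c)) (canon_pair (tr_canon c)).
Proof.
case: c => k; rewrite /pair_equiv /= !mat_ofK !mx_ofE ?trmx1.
- exact: lin_equiv_tr_J.
- by apply/lin_equiv_swap/lin_equiv_tr_J.
- by rewrite tr_diag_rel tr_super_rel; apply: lin_equiv_refl.
- by rewrite tr_diag_rel tr_sub_rel; apply: lin_equiv_refl.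
Qed.

Lemma pair_equiv_empty (P Q : mpair S) :
  pm P = 0%N -> pn P = 0%N -> pm Q = 0%N -> pn Q = 0%N -> pair_equiv P Q.
Proof.
case: P Q => [m n A B] [m' n' A' B'] /= em en em' en'; subst m n m' n'.
rewrite /pair_equiv /= (flatmx0 (mx_of A)) (flatmx0 (mx_of B)) (flatmx0 (mx_of A')) (flatmx0 (mx_of B')).
exact: lin_equiv_refl.
Qed.

Lemma pair_equiv_swap_tail cs : pair_equiv (pair_swap (canon_tail cs)) (canon_tail (map swap_canon cs)).
Proof.
elim: cs => [|c cs IH]; first exact: pair_equiv_empty.
by have := pair_equiv_dsum (pair_equiv_swap_canon c) IH; rewrite /pair_equiv /= !mx_of_dsum.
Qed.

Lemma pair_equiv_tr_tail cs : pair_equiv (pair_tr (canon_tail cs)) (canon_tail (map tr_canon cs)).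
Proof.
elim: cs => [|c cs IH]; first exact: pair_equiv_empty.
have := pair_equiv_dsum (pair_equiv_tr_canon c) IH.
by rewrite /pair_equiv /= !mx_of_dsum !mat_ofK !tr_diag2.
Qed.

(** Left multiplication by [E], the inverse of [D], turns the regular part (D, I_r) of the swapped
    sum into (I_r, E). *)
Lemma canon_sum_swap r (D E : mat S r r) cs :
  mx_of E *m mx_of D = 1%:M ->
  pair_equiv (pair_swap (canon_sum D cs)) (canon_sum E (map swap_canon cs)).
Proof.
move=> ED; rewrite !canon_sumE.
have : pair_equiv (MPair r r D (idm r)) (MPair r r (idm r) E).
  exists 1%:M, 1%:M, (mx_of E), (mx_of D).
  by rewrite /= !mx_ofE ?mulmx1 ED (mulmx1C ED).
by move=> /pair_equiv_dsum/(_ (pair_equiv_swap_tail cs)); rewrite /pair_equiv /= !mx_of_dsum.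
Qed.

Lemma canon_sum_tr r (D : mat S r r) cs :
  pair_equiv (pair_tr (canon_sum D cs)) (canon_sum (mat_of (mx_of D)^T) (map tr_canon cs)).
Proof.
rewrite !canon_sumE.
have : pair_equiv (pair_tr (MPair r r (idm r) D)) (MPair r r (idm r) (mat_of (mx_of D)^T)).
  by rewrite /pair_equiv /= !mat_ofK mx_of_id trmx1; apply: lin_equiv_refl.
move=> /pair_equiv_dsum/(_ (pair_equiv_tr_tail cs)).
by rewrite /pair_equiv /= !mx_of_dsum !mat_ofK !tr_diag2.
Qed.

(* The truncated predecessor makes a canonical pair of size 0 the empty pair, whatever
   its constructor, so blocks are allowed to shrink to size 0 in place. *)
Definition red_canon c :=
  match c with CJI k => CJI k.-1 | CLRT k => CLRT k.-1 | c => c end.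
Definition up_canon c :=
  match c with CJI k => CJI k.+1 | CLRT k => CLRT k.+1 | c => c end.
Definition shrinks_rows c :=
  match c with CJI k | CLRT k => (0 < k)%N | _ => false end.

Lemma pair_reduction_canon c : pair_reduction (canon_pair c) (canon_pair (red_canon c)).
Proof.
case: c => k; rewrite /pair_reduction /= !mx_ofE.
- by apply: (@reduction_id _ _ _ _ _ 1%:M); rewrite mulmx1.
- case: k => [|k] /=; last exact: reduction_JI.
  by apply: (@reduction_id _ _ _ _ _ 1%:M); apply/matrixP => [[]].
- apply: (@reduction_id _ _ _ _ _ (rel_mx K diag_rel k k.-1)).
  by rewrite -rel_mx1; apply: (@rel_mxM _ _ _ _ (fun i l => i)); rel_lia.
- case: k => [|k] /=; last exact: reduction_LRT.
  by apply: (@reduction_id _ _ _ _ _ 1%:M); apply/matrixP => [[]].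
Qed.

Lemma pair_reduction_tail cs : pair_reduction (canon_tail cs) (canon_tail (map red_canon cs)).
Proof.
elim: cs => [|c cs IH]; last exact: pair_reduction_dsum (pair_reduction_canon c) IH.
by apply: (@reduction_id _ _ _ _ _ 1%:M); apply/matrixP => [[]].
Qed.

Lemma pair_reduction_canon_sum r (D : mat S r r) cs :
  pair_reduction (canon_sum D cs) (canon_sum D (map red_canon cs)).
Proof.
apply: pair_reduction_dsum (pair_reduction_tail cs).
by apply: (@reduction_id _ _ _ _ _ 1%:M); rewrite /= mx_of_id mulmx1.
Qed.

Definition canon_pos c := (0 < canon_size c)%N.

Lemma pair_equiv_dsum_empty (P Q : mpair S) : pm P = 0%N -> pn P = 0%N -> pair_equiv (dsum P Q) Q.
Proof.
case: P Q => [m n A B] [m' n' A' B'] /= em en; subst m n.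
rewrite /pair_equiv /= !mx_of_dsum.
have e C (M : 'M[K]_(m', n')) : diag2 (C : 'M[K]_(0, 0)) M = M.
  apply/matrixP=> i j; transitivity (diag2 C M (rshift 0 i) (rshift 0 j)).
    by congr (diag2 _ _ _ _); apply: val_inj.
  exact: block_mxEdr.
by rewrite !e; apply: lin_equiv_refl.
Qed.

(** Disposes of the blocks of size 0 which [red_canon] leaves in place. *)
Lemma pair_equiv_filter_pos r (D : mat S r r) cs :
  pair_equiv (canon_sum D cs) (canon_sum D (seq.filter canon_pos cs)).
Proof.
rewrite !canon_sumE; apply: pair_equiv_dsum; first exact: lin_equiv_refl.
elim: cs => [|c cs IH]; first exact: lin_equiv_refl.
rewrite /=; case: ifPn => [_|c0]; first by apply: pair_equiv_dsum IH; apply: lin_equiv_refl.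
apply: lin_equiv_trans IH; apply: pair_equiv_dsum_empty; by case: c c0 => [[]|[]|[]|[]].
Qed.

Lemma pm_tail_red cs : pm (canon_tail cs) =
  (pm (canon_tail (map red_canon cs)) + count shrinks_rows cs)%N.
Proof. by elim: cs => [//|c cs /= ->]; case: c => [k|k|k|k] /=; lia. Qed.

(** [CLRT 1] is 1 by 0, so its reduction loses a row but no column. *)
Definition shrinks_cols c :=
  match c with CJI k => (0 < k)%N | CLRT k => (1 < k)%N | _ => false end.

Lemma pn_tail_red cs : pn (canon_tail cs) =
  (pn (canon_tail (map red_canon cs)) + count shrinks_cols cs)%N.
Proof. by elim: cs => [//|c cs /= ->]; case: c => [k|k|k|k] /=; lia. Qed.

Lemma pm_tail_cat cs cs' :
  pm (canon_tail (cs ++ cs')) = (pm (canon_tail cs) + pm (canon_tail cs'))%N.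
Proof. by elim: cs => [//|c cs /= ->]; rewrite addnA. Qed.

Lemma pn_tail_cat cs cs' :
  pn (canon_tail (cs ++ cs')) = (pn (canon_tail cs) + pn (canon_tail cs'))%N.
Proof. by elim: cs => [//|c cs /= ->]; rewrite addnA. Qed.

Lemma pm_tail_nseq l c : pm (canon_tail (nseq l c)) = (l * pm (canon_pair c))%N.
Proof. by elim: l => [//|l /= ->]; rewrite mulSn. Qed.

Lemma pn_tail_nseq l c : pn (canon_tail (nseq l c)) = (l * pn (canon_pair c))%N.
Proof. by elim: l => [//|l /= ->]; rewrite mulSn. Qed.

Lemma map_up_canonK cs : map red_canon (map up_canon cs) = cs.
Proof. by elim: cs => [//|c cs /= ->]; case: c. Qed.

Lemma tail_up cs : all canon_pos cs ->
  pm (canon_tail (map up_canon cs)) = (pm (canon_tail cs) + count shrinks_rows cs)%N /\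
  pn (canon_tail (map up_canon cs)) = (pn (canon_tail cs) + count shrinks_rows cs)%N.
Proof.
elim: cs => [//|c cs IH] /= /andP[c0 /IH[-> ->]].
by case: c c0 => [k|k|k|k]; rewrite /canon_pos /=; lia.
Qed.

(** * Existence of the decomposition *)

Definition decomposable m n (A B : 'M[K]_(m, n)) : Prop :=
  exists r (D : mat S r r) cs, [/\ nonsingular D, all canon_pos cs &
    lin_equiv A B (mx_of (pA (canon_sum D cs))) (mx_of (pB (canon_sum D cs)))].

Lemma swap_canon_pos cs : all canon_pos (map swap_canon cs) = all canon_pos cs.
Proof. by rewrite all_map; apply: eq_all; case. Qed.

Lemma tr_canon_pos cs : all canon_pos (map tr_canon cs) = all canon_pos cs.
Proof. by rewrite all_map; apply: eq_all; case. Qed.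

Lemma decomposable_swap m n (A B : 'M[K]_(m, n)) : decomposable A B -> decomposable B A.
Proof.
move=> [r [D [cs [/nonsingularP[E [DE ED]] cs0 AB]]]].
exists r, (mat_of E), (map swap_canon cs); split.
- by apply/nonsingularP; exists (mx_of D); rewrite mat_ofK.
- by rewrite swap_canon_pos.
apply: lin_equiv_trans (lin_equiv_swap AB) _.
by apply: canon_sum_swap; rewrite mat_ofK.
Qed.

Lemma decomposable_tr m n (A B : 'M[K]_(m, n)) : decomposable A^T B^T -> decomposable A B.
Proof.
move=> [r [D [cs [/nonsingularP[E [DE ED]] cs0 AB]]]].
exists r, (mat_of (mx_of D)^T), (map tr_canon cs); split.
- by apply/nonsingularP; exists E^T; rewrite mat_ofK -!trmx_mul DE ED trmx1.
- by rewrite tr_canon_pos.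
have := lin_equiv_tr AB; rewrite !trmxK => AB'; apply: lin_equiv_trans AB' _.
by have := canon_sum_tr D cs; rewrite /pair_equiv /= !mat_ofK.
Qed.

(** The blocks of a decomposition of the reduction are enlarged by [up_canon], and blocks that
    reduce to nothing are added until the size is that of the given pair. Both pairs then have the
    same size and the same reduction, and [reduction_unique] applies. *)
Lemma decomposable_reduce m n (A B : 'M[K]_(m, n)) :
  (forall m1 n1 (A1 B1 : 'M[K]_(m1, n1)), (m1 + n1 < m + n)%N -> decomposable A1 B1) ->
  (\rank A < m)%N -> decomposable A B.
Proof.
move=> IH rA; have [n1 [A1 [B1 red1]]] := reduction_exists A B.
have [b0 [_ [nb0 _ _ _]]] := reduction_size red1.
have [|r [D [cs [nD cs0 AB1]]]] := IH _ _ A1 B1; first by lia.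
have redQ := reduction_lin_equiv red1 AB1.
have [b [c [nb mc bc rb]]] := reduction_size redQ.
have rk := reduction_rank (pair_reduction_canon_sum D cs).
rewrite {}rk !pm_canon_sum pm_tail_red in rb; set t := count _ _ in rb.
have tb : (t <= b)%N by lia.
(* The enlarged blocks add [t] rows and [t] columns. Each [CJI 1] adds one of both and each [CLRT 1]
   a row only, which makes [c] more rows and [b] more columns in all. *)
pose cs' := nseq (b - t) (CJI 1) ++ nseq (c - b) (CLRT 1) ++ map up_canon cs.
have [pm_up pn_up] := tail_up cs0; rewrite -/t in pm_up pn_up.
have pm' : pm (canon_sum D cs') = m.
  by rewrite mc !pm_canon_sum !pm_tail_cat !pm_tail_nseq pm_up /=; lia.
have pn' : pn (canon_sum D cs') = n.
  by rewrite nb !pn_canon_sum !pn_tail_cat !pn_tail_nseq pn_up /=; lia.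
have red' : pair_reduction (canon_sum D cs') (canon_sum D cs).
  have := pair_reduction_canon_sum D cs'; move=> /reduction_lin_equiv; apply.
  apply: lin_equiv_trans (pair_equiv_filter_pos _ _) _.
  rewrite !map_cat map_up_canonK !map_nseq !filter_cat.
  have fn l k : seq.filter canon_pos (nseq l k) = if canon_pos k then nseq l k else [::].
    by elim: l => [|l /= ->]; case: (canon_pos k).
  by rewrite !fn /= (all_filterP cs0); apply: lin_equiv_refl.
exists r, D, cs'; split=> //.
  rewrite !all_cat !all_nseq /= !orbT /= all_map.
  by apply: sub_all cs0; case=> [[]|[]|[]|[]].
move: red' pm' pn'; rewrite /pair_reduction; move: (canon_sum D cs') => [m' n' A' B'] /= red' em en.
by subst m' n'; apply: reduction_unique redQ red'.
Qed.

Theorem pencil_decomposable m n (A B : 'M[K]_(m, n)) : decomposable A B.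
Proof.
have [N] := ubnP (m + n)%N; elim: N m n A B => [//|N IH] m n A B mnN.
have red m' n' (A' B' : 'M[K]_(m', n')) : (m' + n' = m + n)%N -> (\rank A' < m')%N -> decomposable A' B'.
  by move=> e; apply: decomposable_reduce => m1 n1 A1 B1 lt1; apply: IH; lia.
have [/red|mA] := ltnP (\rank A) m; first exact.
have [/red redB|mB] := ltnP (\rank B) m; first by apply/decomposable_swap/redB.
have [nA|nA] := ltnP (\rank A) n.
  by apply/decomposable_tr/red; rewrite ?mxrank_tr // addnC.
have [nB|nB] := ltnP (\rank B) n.
  by apply/decomposable_tr/decomposable_swap/red; rewrite ?mxrank_tr // addnC.
have rA : \rank A = m by apply/eqP; rewrite eqn_leq rank_leq_row.
have rB : \rank B = m by apply/eqP; rewrite eqn_leq rank_leq_row.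
have en : n = m by apply/eqP; rewrite eqn_leq -{1}rA -{2}rA nA rank_leq_col.
subst n; have uA : A \in unitmx by rewrite -row_full_unit /row_full rA.
have uB : B \in unitmx by rewrite -row_full_unit /row_full rB.
(* Both matrices are now invertible: left multiplication by [invmx A] leaves only the regular
   part. *)
exists m, (mat_of (invmx A *m B)), [::]; split=> //.
  apply/nonsingularP; exists (invmx B *m A); rewrite mat_ofK.
  by rewrite !mulmxA !mulmxK // !mulVmx.
rewrite canon_sumE !mx_of_dsum /= mat_ofK mx_of_id.
apply: lin_equiv_trans (lin_equiv_sym (lin_equiv_diag2_0r _ _ _ _)).
exists 1%:M, 1%:M, (invmx A), A.
by rewrite !mulmx1 mulmxV // mulVmx.
Qed.

End Canonical.

(** * Topological equivalence *)

Arguments sdist {s} _ _.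

Lemma vdist_ltP (F : scalars) n (x y : vec F n) (e : R) : Rlt 0 e ->
  Rlt (vdist x y) e <-> forall i, Rlt (sdist (x i) (y i)) e.
Proof.
move=> e0; rewrite /vdist.
have H (s : seq 'I_n) : Rlt (\big[Rmax/0%R]_(i <- s) sdist (x i) (y i)) e <->
    forall i, i \in s -> Rlt (sdist (x i) (y i)) e.
  elim: s => [|a s IH]; first by rewrite big_nil.
  rewrite big_cons; split=> [lt i|lt].
    have [ltF lt'] := (Rmax_Rlt _ _ _).1 lt.
    by rewrite inE => /predU1P[-> //|]; apply: (IH.1 lt').
  apply: Rmax_lub_lt; first by apply: lt; rewrite inE eqxx.
  by apply/IH => i si; apply: lt; rewrite inE si orbT.
split=> [/H lt i|lt]; first by apply: lt; rewrite mem_index_enum.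
by apply/H.
Qed.

Lemma continuous_mapP (F : scalars) n m (f : vec F n -> vec F m) :
  continuous_map f <-> forall x e, Rlt 0 e -> exists d, Rlt 0 d /\
    forall y, (forall i, Rlt (sdist (y i) (x i)) d) -> forall i, Rlt (sdist (f y i) (f x i)) e.
Proof.
split=> fc x e e0; have [d [d0 fd]] := fc x e e0; exists d; split=> // y.
  by move=> /(vdist_ltP y x d0)/fd/(vdist_ltP (f y) (f x) e0).
by move=> /(vdist_ltP y x d0)/fd/(vdist_ltP (f y) (f x) e0).
Qed.

Lemma continuous_comp (F : scalars) n m p (f : vec F n -> vec F m) (g : vec F m -> vec F p) :
  continuous_map f -> continuous_map g -> continuous_map (g \o f).
Proof.
move=> fc gc x e e0; have [d [d0 gd]] := gc (f x) e e0.
have [d' [d'0 fd']] := fc x d d0; exists d'; split=> // y /fd'; exact: gd.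
Qed.

Lemma homeomorphism_comp (F : scalars) n m p (f : vec F n -> vec F m) (g : vec F m -> vec F p) :
  homeomorphism f -> homeomorphism g -> homeomorphism (g \o f).
Proof.
move=> [f' [fc [fc' [fK f'K]]]] [g' [gc [gc' [gK g'K]]]].
exists (f' \o g'); split; first exact: continuous_comp.
split; first exact: continuous_comp.
by split=> x /=; rewrite ?gK ?f'K.
Qed.

Lemma top_equiv_sym (F : scalars) (P Q : mpair F) : top_equiv P Q -> top_equiv Q P.
Proof.
move=> [phi [psi [[phi' [c1 [c2 [k1 k2]]]] [[psi' [c3 [c4 [k3 k4]]]] [eA eB]]]]].
exists phi', psi'; split; first by exists phi.
split; first by exists psi.
by split=> v; rewrite -{1}[v]k2 -?eA -?eB k3.
Qed.

Lemma top_equiv_trans (F : scalars) (P Q M : mpair F) :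
  top_equiv P Q -> top_equiv Q M -> top_equiv P M.
Proof.
move=> [f [g [hf [hg [eA eB]]]]] [f' [g' [hf' [hg' [eA' eB']]]]].
exists (f' \o f), (g' \o g); split; first exact: homeomorphism_comp.
split; first exact: homeomorphism_comp.
by split=> v /=; rewrite ?eA ?eA' ?eB ?eB'.
Qed.

Section Topological.
Variables (K : fieldType) (dist : K -> K -> R) (nrm : K -> R).
Hypothesis distE : forall x y, dist x y = nrm (x - y).
Hypothesis nrm0 : nrm 0 = 0.
Hypothesis nrm_ge0 : forall x, 0 <= nrm x.
Hypothesis nrmD : forall x y, nrm (x + y) <= nrm x + nrm y.
Hypothesis nrmM : forall x y, nrm (x * y) <= nrm x * nrm y.
Local Notation S := (field_scalars dist).
(** Invariance of dimension is assumed here so that one argument serves both fields;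
    [real_homeo_dim] and [complex_homeo_dim] provide it. *)
Hypothesis homeo_dim : forall n n' (f : vec S n -> vec S n'), homeomorphism f -> n = n'.
Local Notation canon_tail := (canon_tail dist).
Local Notation pm := (@Defs.pm S).
Local Notation pn := (@Defs.pn S).
Local Notation pA := (@Defs.pA S).
Local Notation pB := (@Defs.pB S).

(** * Matrices as continuous maps *)

Definition mv m n (M : 'M[K]_(m, n)) (v : vec S n) : vec S m :=
  fun i => \sum_j M i j * v j.

Lemma mulmvE m n (A : mat S m n) v : mulmv A v = mv (mx_of A) v.
Proof. by apply/funext => i; apply: eq_bigr => j _; rewrite mxE. Qed.

Lemma mvM m n p (M : 'M[K]_(m, n)) (N : 'M[K]_(n, p)) v : mv (M *m N) v = mv M (mv N v).
Proof.
apply/funext => i; rewrite /mv.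
under eq_bigr do rewrite mxE mulr_suml.
rewrite exchange_big; apply: eq_bigr => j _; rewrite mulr_sumr.
by apply: eq_bigr => k _; rewrite mulrA.
Qed.

Lemma mv1 n v : mv (1%:M : 'M[K]_n) v = v.
Proof.
apply/funext => i; rewrite /mv (bigD1 i) //= mxE eqxx mul1r big1 ?addr0 // => j ji.
by rewrite mxE eq_sym (negPf ji) mul0r.
Qed.

Lemma mvD m n (M N : 'M[K]_(m, n)) v i : mv (M + N) v i = mv M v i + mv N v i.
Proof. by rewrite /mv -big_split; apply: eq_bigr => j _; rewrite mxE mulrDl. Qed.

Lemma mv0 m n v i : mv (0 : 'M[K]_(m, n)) v i = 0.
Proof. by rewrite /mv big1 // => j _; rewrite mxE mul0r. Qed.

Lemma nrm_sum (I : finType) (f : I -> K) : nrm (\sum_i f i) <= \sum_i nrm (f i).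
Proof.
elim/big_ind2: _ => [|x r y s xr ys|//]; first by rewrite nrm0.
exact: le_trans (nrmD _ _) (lerD xr ys).
Qed.

Lemma mv_continuous m n (M : 'M[K]_(m, n)) : continuous_map (mv M).
Proof.
apply/continuous_mapP => x e /RltP e0.
pose C : R := 1 + \sum_i \sum_j nrm (M i j).
have C0 : 0 < C by rewrite ltr_pwDl // sumr_ge0 // => i _; rewrite sumr_ge0.
have d0 : 0 < e / C by apply: divr_gt0.
exists (e / C); split=> [|y yx i]; first exact/RltP.
apply/RltP; rewrite /= distE -sumrB.
apply: le_lt_trans (nrm_sum _) _.
apply: (@le_lt_trans _ _ (\sum_j nrm (M i j) * (e / C))).
  apply: ler_sum => j _; rewrite -mulrBr; apply: le_trans (nrmM _ _) _.
  by rewrite ler_wpM2l // -distE; apply/ltW/RltP/yx.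
rewrite -mulr_suml -[ltRHS](divfK (lt0r_neq0 C0)) mulrC ltr_pM2l //.
have le_row : \sum_j nrm (M i j) <= \sum_k \sum_j nrm (M k j).
  by rewrite [leRHS](bigD1 i) //= lerDl sumr_ge0 // => k _; rewrite sumr_ge0.
by apply: le_lt_trans le_row _; rewrite ltrDr.
Qed.

(** Serves for maps induced on subspaces, with [N] an inclusion and [M] a retraction, and on
    quotients, with [M] a projection and [N] a section. *)
Lemma sandwich_homeomorphism a b c d (f : vec S a -> vec S b) g
    (M : 'M[K]_(c, b)) (N : 'M[K]_(a, d)) (M' : 'M[K]_(b, c)) (N' : 'M[K]_(d, a)) :
  continuous_map f -> continuous_map g ->
  cancel (mv M \o f \o mv N) (mv N' \o g \o mv M') ->
  cancel (mv N' \o g \o mv M') (mv M \o f \o mv N) ->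
  homeomorphism (mv M \o f \o mv N).
Proof.
move=> fc gc k1 k2; exists (mv N' \o g \o mv M').
split; first exact: continuous_comp (mv_continuous _) (continuous_comp fc (mv_continuous _)).
by split; first exact: continuous_comp (mv_continuous _) (continuous_comp gc (mv_continuous _)).
Qed.

Lemma mv_homeomorphism m n (M : 'M[K]_(m, n)) N :
  N *m M = 1%:M -> M *m N = 1%:M -> homeomorphism (mv M).
Proof.
move=> NM MN; exists (mv N); split; first exact: mv_continuous.
split; first exact: mv_continuous.
by split=> v; rewrite -mvM ?NM ?MN mv1.
Qed.

Lemma pair_equiv_top_equiv (P Q : mpair S) : pair_equiv P Q -> top_equiv P Q.
Proof.
move=> [U [U' [V [V' [[e1 e2 e3 e4] [eA eB]]]]]].
exists (mv U), (mv V); split; first exact: mv_homeomorphism e1 e2.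
split; first exact: mv_homeomorphism e3 e4.
by split=> v; rewrite !mulmvE -!mvM ?eA ?eB.
Qed.

Lemma top_equiv_dim (P Q : mpair S) : top_equiv P Q -> pm P = pm Q /\ pn P = pn Q.
Proof. by move=> [phi [psi [/homeo_dim ? [/homeo_dim ? _]]]]. Qed.

(* The subsets im A and B^-1(im A) are defined without reference to the linear
   structure, hence preserved by any topological equivalence. *)
Lemma pair_reduction_top_equiv (P Q P1 Q1 : mpair S) :
  pair_reduction P P1 -> pair_reduction Q Q1 -> top_equiv P Q -> top_equiv P1 Q1.
Proof.
move=> [I [I' [J [J' [X [Y [Z [[I1 J1 AI BI] [AX JY IZ ZA]]]]]]]]].
move=> [i [i' [j [j' [x [y [z [[i1 j1 Ai Bi] [Ax jy iz zA]]]]]]]]].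
move=> [phi [psi [[phi' [c1 [c2 [k1 k2]]]] [[psi' [c3 [c4 [k3 k4]]]] [eA0 eB0]]]]].
have eA v : psi (mv (mx_of (pA P)) v) = mv (mx_of (pA Q)) (phi v) by rewrite -!mulmvE.
have eB v : psi (mv (mx_of (pB P)) v) = mv (mx_of (pB Q)) (phi v) by rewrite -!mulmvE.
have eA' v : psi' (mv (mx_of (pA Q)) v) = mv (mx_of (pA P)) (phi' v) by rewrite -{1}[v]k2 -eA k3.
have eB' v : psi' (mv (mx_of (pB Q)) v) = mv (mx_of (pB P)) (phi' v) by rewrite -{1}[v]k2 -eB k3.
have jpsi v : mv j (mv j' (psi (mv J v))) = psi (mv J v).
  by rewrite JY mvM eA Ax !mvM -!(mvM j') j1 mv1.
have Jpsi v : mv J (mv J' (psi' (mv j v))) = psi' (mv j v).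
  by rewrite jy mvM eA' AX !mvM -!(mvM J') J1 mv1.
(* It suffices that [z] kills B of [phi (I v)], which is [psi (B I v)]. As [B I v] lies in im A, its
   image under [psi] lies in the image of the A of [Q], where [z] vanishes. *)
have iphi v : mv i (mv i' (phi (mv I v))) = phi (mv I v).
  rewrite -[RHS]mv1 iz; apply/funext => k; rewrite mvD -mvM -[LHS]addr0; congr (_ + _).
  by rewrite mvM -eB -mvM BI JY -mulmxA mvM eA -mvM zA mv0.
have Iphi v : mv I (mv I' (phi' (mv i v))) = phi' (mv i v).
  rewrite -[RHS]mv1 IZ; apply/funext => k; rewrite mvD -mvM -[LHS]addr0; congr (_ + _).
  by rewrite mvM -eB' -mvM Bi jy -mulmxA mvM eA' -mvM ZA mv0.
exists (mv i' \o phi \o mv I), (mv j' \o psi \o mv J); split.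
  apply: (sandwich_homeomorphism (g := phi') (M' := i) (N' := I')) => // v /=.
    by rewrite iphi k1 -mvM I1 mv1.
  by rewrite Iphi k2 -mvM i1 mv1.
split.
  apply: (sandwich_homeomorphism (g := psi') (M' := j) (N' := J')) => // v /=.
    by rewrite jpsi k3 -mvM J1 mv1.
  by rewrite Jpsi k4 -mvM j1 mv1.
split=> v; rewrite !mulmvE /=.
  by rewrite -(mvM J) -AI mvM eA -[in LHS]iphi -(mvM _ i) Ai mvM -(mvM j') j1 mv1.
by rewrite -(mvM J) -BI mvM eB -[in LHS]iphi -(mvM _ i) Bi mvM -(mvM j') j1 mv1.
Qed.

(* Dually, a topological equivalence preserves the equivalence relations A v = A v'
   on the source and, when B is onto, {(B v, B v') | A v = A v'} on the target. *)
Lemma coreduction_top_equiv (P Q P1 Q1 : mpair S) C c :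
  pair_reduction (pair_tr P) (pair_tr P1) -> pair_reduction (pair_tr Q) (pair_tr Q1) ->
  mx_of (pB P) *m C = 1%:M -> mx_of (pB Q) *m c = 1%:M ->
  top_equiv P Q -> top_equiv P1 Q1.
Proof.
rewrite /pair_reduction /= !mat_ofK.
(* The transposed reduction: [p] and [q] project onto the quotients, with sections [p'] and [q'].
   The vectors [D w] and [E w] have the same image under A, while B maps them to [w] and [q' q w];
   this exhibits [w] and [q' q w] as related. *)
have dual (M M1 : mpair S) (D : 'M_(pn M, pm M)) :
    reduction (mx_of (pA M))^T (mx_of (pB M))^T (mx_of (pA M1))^T (mx_of (pB M1))^T ->
    mx_of (pB M) *m D = 1%:M ->
  exists (p : 'M_(pn M1, pn M)) (p' : 'M_(pn M, pn M1))
    (q : 'M_(pm M1, pm M)) (q' : 'M_(pm M, pm M1))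
    (x : 'M_(pm M, pn M1)) (y : 'M_(pn M1, pm M)) (E : 'M_(pn M, pm M)),
    [/\ p *m p' = 1%:M, q *m q' = 1%:M, q *m mx_of (pA M) = mx_of (pA M1) *m p &
        q *m mx_of (pB M) = mx_of (pB M1) *m p] /\
    [/\ mx_of (pA M) = x *m p, p = y *m mx_of (pA M),
        mx_of (pB M) *m E = q' *m q & mx_of (pA M) *m E = mx_of (pA M) *m D].
  move=> [I [I' [J [J' [X [Y [Z [[I1 J1 AI BI] [AX JY IZ ZA]]]]]]]]] BD.
  have q1 : I^T *m I'^T = 1%:M by rewrite -trmx_mul I1 trmx1.
  have BZ : 1%:M = I'^T *m I^T + mx_of (pB M) *m Z^T.
    by have := congr1 trmx IZ; rewrite trmx1 linearD /= !trmx_mul !trmxK.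
  exists J^T, J'^T, I^T, I'^T, X^T, Y^T, (D - Z^T *m (1%:M - I'^T *m I^T)).
  split; split.
  - by rewrite -trmx_mul J1 trmx1.
  - exact: q1.
  - by apply: trmx_inj; rewrite !trmx_mul !trmxK AI.
  - by apply: trmx_inj; rewrite !trmx_mul !trmxK BI.
  - by apply: trmx_inj; rewrite trmx_mul !trmxK.
  - by apply: trmx_inj; rewrite trmx_mul !trmxK.
  - have -> : mx_of (pB M) *m (D - Z^T *m (1%:M - I'^T *m I^T)) =
       1%:M - (mx_of (pB M) *m Z^T) *m (1%:M - I'^T *m I^T).
      by rewrite mulmxBr BD !mulmxA.
    have -> : mx_of (pB M) *m Z^T = 1%:M - I'^T *m I^T by rewrite BZ addrC addKr.
    rewrite mulmxBl mul1mx mulmxBr mulmx1 -mulmxA (mulmxA I^T) q1 mul1mx subrr subr0.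
    by rewrite opprB addrC subrK.
  - have AZ : mx_of (pA M) *m Z^T = 0.
      by apply: trmx_inj; rewrite trmx_mul trmxK ZA trmx0.
    by rewrite mulmxBr mulmxA AZ mul0mx subr0.
move=> /dual redP /dual redQ BC Bc [phi [psi [hphi [hpsi [eA0 eB0]]]]].
have [p [p' [q [q' [x [y [E [[p1 q1 qA qB] [Ax py BE AE]]]]]]]]] := redP C BC.
have [r [r' [s [s' [z [t [G [[r1 s1 sA sB] [Az rt BG AG]]]]]]]]] := redQ c Bc.
(* The maps induced by [f] and [g] on the quotients do not depend on the representatives. This is
   stated for arbitrary pairs, to be applied to the equivalence and to its inverse. *)
have step (M N : mpair S) (f : vec S (pn M) -> vec S (pn N)) (g : vec S (pm M) -> vec S (pm N)) 
    n1 n2 m1 m2 (a : 'M_(n1, _)) a' (b : 'M_(m1, _)) b' (a2 : 'M_(n2, _)) (b2 : 'M_(m2, pm N))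
    B2 X Y (D H : 'M_(_, pm M)) :
  (forall v, g (mv (mx_of (pA M)) v) = mv (mx_of (pA N)) (f v)) ->
  (forall v, g (mv (mx_of (pB M)) v) = mv (mx_of (pB N)) (f v)) ->
  a *m a' = 1%:M -> mx_of (pA M) = X *m a -> a2 = Y *m mx_of (pA N) ->
  b2 *m mx_of (pB N) = B2 *m a2 -> mx_of (pB M) *m D = 1%:M ->
  mx_of (pB M) *m H = b' *m b -> mx_of (pA M) *m H = mx_of (pA M) *m D ->
  (forall v, mv a2 (f (mv a' (mv a v))) = mv a2 (f v)) /\
  (forall w, mv b2 (g (mv b' (mv b w))) = mv b2 (g w)).
  move=> gA gB aa AX a2Y b2B BD BH AH; split=> [v|w].
    by rewrite a2Y !mvM -!gA {1}AX mvM -(mvM a) aa mv1 -mvM -AX.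
  rewrite -(mvM b') -BH mvM gB -mvM b2B -{2}[w]mv1 -BD (mvM _ D) gB -(mvM b2) b2B.
  by rewrite a2Y !mvM -!gA -!mvM AH.
have eA v : psi (mv (mx_of (pA P)) v) = mv (mx_of (pA Q)) (phi v) by rewrite -!mulmvE.
have eB v : psi (mv (mx_of (pB P)) v) = mv (mx_of (pB Q)) (phi v) by rewrite -!mulmvE.
have [f1 f2] := step P Q phi psi _ _ _ _ _ _ _ _ _ _ _ _ _ _ _ eA eB p1 Ax rt sB BC BE AE.
move: hphi hpsi => [phi' [c1 [c2 [k1 k2]]]] [psi' [c3 [c4 [k3 k4]]]].
have eA' v : psi' (mv (mx_of (pA Q)) v) = mv (mx_of (pA P)) (phi' v) by rewrite -{1}[v]k2 -eA k3.
have eB' v : psi' (mv (mx_of (pB Q)) v) = mv (mx_of (pB P)) (phi' v) by rewrite -{1}[v]k2 -eB k3.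
have [g1 g2] := step Q P phi' psi' _ _ _ _ _ _ _ _ _ _ _ _ _ _ _ eA' eB' r1 Az py qB Bc BG AG.
exists (mv r \o phi \o mv p'), (mv s \o psi \o mv q'); split.
  apply: (sandwich_homeomorphism (g := phi') (M' := r') (N' := p)) => // v /=.
    by rewrite g1 k1 -mvM p1 mv1.
  by rewrite f1 k2 -mvM r1 mv1.
split.
  apply: (sandwich_homeomorphism (g := psi') (M' := s') (N' := q)) => // v /=.
    by rewrite g2 k3 -mvM q1 mv1.
  by rewrite f2 k4 -mvM s1 mv1.
split=> v; rewrite !mulmvE /=.
  rewrite -[mx_of (pA P1)]mulmx1 -p1 mulmxA -qA -mulmxA 2!mvM f2.
  by rewrite eA -!mvM sA.
rewrite -[mx_of (pB P1)]mulmx1 -p1 mulmxA -qB -mulmxA 2!mvM f2.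
by rewrite eB -!mvM sB.
Qed.

(* Passing to the quotients by ker A and B (ker A). *)
Definition cored_canon c := match c with CLR k => CLR k.-1 | c => c end.
(** The blocks left once the reductions of (A, B) and (B, A) no longer shrink anything: the (L_k,
    R_k) and remnants of size 0. *)
Definition canon_flat c := match c with CLR k => true | c => canon_size c == 0%N end.

Lemma coreduction_canon c : canon_flat c ->
  pair_reduction (pair_tr (@canon_pair S c)) (pair_tr (canon_pair (cored_canon c))).
Proof.
rewrite /pair_reduction /= !mat_ofK; case: c => k /=; last first.
- by move=> /eqP->; apply: (@reduction_id _ _ _ _ _ 0); apply/matrixP => [[]].
- move=> _; rewrite !mx_ofE !tr_diag_rel !tr_super_rel.
  case: k => [|k] /=; last exact: reduction_LRT.
  by apply: (@reduction_id _ _ _ _ _ 0); apply/matrixP => [[]].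
- by move=> /eqP->; apply: (@reduction_id _ _ _ _ _ 0); apply/matrixP => [[]].
- by move=> /eqP->; apply: (@reduction_id _ _ _ _ _ 0); apply/matrixP => [[]].
Qed.

Lemma coreduction_dsum (P Q P1 Q1 : mpair S) :
  pair_reduction (pair_tr P) (pair_tr P1) -> pair_reduction (pair_tr Q) (pair_tr Q1) ->
  pair_reduction (pair_tr (dsum P Q)) (pair_tr (dsum P1 Q1)).
Proof.
by rewrite /pair_reduction /= !mat_ofK !mx_of_dsum !tr_diag2; apply: reduction_diag2.
Qed.

Lemma coreduction_canon_sum r (D : mat S r r) cs : all canon_flat cs ->
  pair_reduction (pair_tr (canon_sum D cs)) (pair_tr (canon_sum D (map cored_canon cs))).
Proof.
move=> fcs; apply: coreduction_dsum.
  apply: (@reduction_id _ _ _ _ _ 1%:M).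
  by rewrite /= mat_ofK mx_of_id trmx1 mulmx1.
elim: cs fcs => [_|c cs IH /= /andP[fc /IH fcs]].
  by apply: (@reduction_id _ _ _ _ _ 0); apply/matrixP => [[]].
exact: coreduction_dsum (coreduction_canon fc) fcs.
Qed.

(** Supplies the surjectivity of B required by [coreduction_top_equiv]; a shift is a right inverse
    of R_k. *)
Lemma canon_sum_right_inverse r (D : mat S r r) cs : nonsingular D -> all canon_flat cs ->
  exists C, mx_of (pB (canon_sum D cs)) *m C = 1%:M.
Proof.
move=> /nonsingularP[E [DE _]] fcs.
have [C CK] : exists C, mx_of (pB (canon_tail cs)) *m C = 1%:M.
  elim: cs fcs => [_|c cs IH /= /andP[fc /IH[C CK]]].
    by exists 0; apply/matrixP => [[]].
  have [C' CK'] : exists C', mx_of (pB (canon_pair c)) *m C' = 1%:M.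
    case: c fc => k /=; last by move=> /eqP->; exists 0; apply/matrixP => [[]].
    - by move=> /eqP->; exists 0; apply/matrixP => [[]].
    - by move=> /eqP->; exists 0; apply/matrixP => [[]].
    move=> _; exists (rel_mx K sub_rel k k.-1); rewrite mx_of_R -rel_mx1.
    by apply: (@rel_mxM _ _ _ _ (fun i l => i.+1)); rel_lia.
  by exists (diag2 C' C); rewrite mx_of_dsum diag2M CK CK' diag2_1.
by exists (diag2 E C); rewrite mx_of_dsum diag2M DE CK diag2_1.
Qed.

(** Multiplicities are compared through arbitrary predicates, which can be transported along a
    reduction. Blocks of size 0 are not counted, as their kinds all give the empty pair. *)
Definition same_invariants r (D : mat S r r) cs r' (D' : mat S r' r') cs' : Prop :=
  [/\ r = r', top_similar D D' &
      forall p : pred canon, (forall c, p c -> canon_pos c) -> count p cs = count p cs'].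

Definition is_CJI1 c := if c is CJI 1 then true else false.
Definition is_CLRT1 c := if c is CLRT 1 then true else false.
Definition is_CLR1 c := if c is CLR 1 then true else false.

(** [p] read on the reduction, where a shortened block of size [k] comes from one of size [k.+1].
    Remnants of size 0 are excluded, to comply with [same_invariants]. *)
Definition red_pred (p : pred canon) c :=
  match c with
  | CJI k => (0 < k)%N && p (CJI k.+1)
  | CLRT k => (0 < k)%N && p (CLRT k.+1)
  | c => p c
  end.

Lemma count_red (p : pred canon) cs : (forall c, p c -> canon_pos c) ->
  count p cs = (count (red_pred p) (map red_canon cs)
    + p (CJI 1) * count is_CJI1 cs + p (CLRT 1) * count is_CLRT1 cs)%N.
Proof.
move=> pP; have pJ : p (CJI 0) = false by apply/negP => /pP.
have pT : p (CLRT 0) = false by apply/negP => /pP.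
elim: cs => [|c cs IH] /=; first by rewrite !muln0.
rewrite {}IH; case: c => [k|[|[|k]]|k|[|[|k]]] /=; rewrite ?pJ ?pT; lia.
Qed.

Lemma count_shrinks_rows cs : count shrinks_rows cs =
  (count shrinks_rows (map red_canon cs) + count is_CJI1 cs + count is_CLRT1 cs)%N.
Proof. by elim: cs => [//|c cs /= ->]; case: c => [k|[|[|k]]|k|[|[|k]]] /=; lia. Qed.

Lemma count_shrinks_cols cs : count shrinks_cols cs =
  (count shrinks_rows (map red_canon cs) + count is_CJI1 cs)%N.
Proof. by elim: cs => [//|c cs /= ->]; case: c => [k|[|[|k]]|k|[|[|k]]] /=; lia. Qed.

Lemma canon_sum_dims r (D : mat S r r) cs r' (D' : mat S r' r') cs' :
  top_equiv (canon_sum D cs) (canon_sum D' cs') ->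
  (r + pm (canon_tail cs) = r' + pm (canon_tail cs'))%N /\
  (r + pn (canon_tail cs) = r' + pn (canon_tail cs'))%N.
Proof. exact: top_equiv_dim. Qed.

(** Blocks surviving the reduction are counted there. The numbers of [CJI 1] and [CLRT 1], which
    vanish, follow from the drops in the numbers of rows and columns: the former lose one of each,
    the latter a row only. *)
Lemma same_invariants_red r (D : mat S r r) cs r' (D' : mat S r' r') cs' :
  top_equiv (canon_sum D cs) (canon_sum D' cs') ->
  (top_equiv (canon_sum D (map red_canon cs)) (canon_sum D' (map red_canon cs')) ->
   same_invariants D (map red_canon cs) D' (map red_canon cs')) ->
  same_invariants D cs D' cs'.
Proof.
move=> te IH.
have te' := pair_reduction_top_equiv (pair_reduction_canon_sum D cs) (pair_reduction_canon_sum D' cs') te.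
have [e sim cnt] := IH te'.
have [em en] := canon_sum_dims te; have [em' en'] := canon_sum_dims te'.
have m1 := pm_tail_red dist cs; have m2 := pm_tail_red dist cs'.
have n1 := pn_tail_red dist cs; have n2 := pn_tail_red dist cs'.
rewrite count_shrinks_rows in m1; rewrite count_shrinks_rows in m2.
rewrite count_shrinks_cols in n1; rewrite count_shrinks_cols in n2.
have eg : count shrinks_rows (map red_canon cs) = count shrinks_rows (map red_canon cs').
  by apply: cnt; case=> [k|k|k|k].
have eJ : count is_CJI1 cs = count is_CJI1 cs' by lia.
have eT : count is_CLRT1 cs = count is_CLRT1 cs' by lia.
split=> // p pP; rewrite (count_red cs pP) (count_red cs' pP) eJ eT (cnt (red_pred p)) //.
by case=> k /=; [apply: pP|case/andP|apply: pP|case/andP].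
Qed.

(** In a flat list all blocks other than the [CLR] have size 0, whence the default [false]. *)
Definition cored_pred (p : pred canon) c :=
  if c is CLR k then (0 < k)%N && p (CLR k.+1) else false.

Lemma count_cored (p : pred canon) cs : (forall c, p c -> canon_pos c) ->
  all canon_flat cs ->
  count p cs = (count (cored_pred p) (map cored_canon cs) + p (CLR 1) * count is_CLR1 cs)%N.
Proof.
move=> pP; have p0 c : canon_size c = 0%N -> p c = false.
  by move=> c0; apply/negP => /pP; rewrite /canon_pos c0.
elim: cs => [|c cs IH] /=; first by rewrite !muln0.
case/andP=> fc /IH->; case: c fc => [k|k|[|[|k]]|k] /= => [/eqP k0|/eqP k0|_|_|_|/eqP k0];
  rewrite ?(p0 (CIJ k)) ?(p0 (CJI k)) ?(p0 (CLRT k)) ?(p0 (CLR 0)) //; lia.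
Qed.

Definition is_CLR c := if c is CLR k then (0 < k)%N else false.

Lemma pn_tail_cored cs : pn (canon_tail cs) =
  (pn (canon_tail (map cored_canon cs)) + count is_CLR (map cored_canon cs) + count is_CLR1 cs)%N.
Proof. by elim: cs => [//|c cs /= ->]; case: c => [k|k|[|[|k]]|k] /=; lia. Qed.

(** The blocks which vanish are now the [CLR 1], of size 0 by 1; the drop in the number of columns
    determines how many there are. *)
Lemma same_invariants_cored r (D : mat S r r) cs r' (D' : mat S r' r') cs' :
  nonsingular D -> nonsingular D' -> all canon_flat cs -> all canon_flat cs' ->
  top_equiv (canon_sum D cs) (canon_sum D' cs') ->
  (top_equiv (canon_sum D (map cored_canon cs)) (canon_sum D' (map cored_canon cs')) ->
   same_invariants D (map cored_canon cs) D' (map cored_canon cs')) ->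
  same_invariants D cs D' cs'.
Proof.
move=> nD nD' fcs fcs' te IH.
have [C CK] := canon_sum_right_inverse nD fcs.
have [C' CK'] := canon_sum_right_inverse nD' fcs'.
have te' := coreduction_top_equiv (coreduction_canon_sum D fcs)
  (coreduction_canon_sum D' fcs') CK CK' te.
have [e sim cnt] := IH te'.
have [_ en] := canon_sum_dims te; have [_ en'] := canon_sum_dims te'.
have n1 := pn_tail_cored cs; have n2 := pn_tail_cored cs'.
have eg : count is_CLR (map cored_canon cs) = count is_CLR (map cored_canon cs').
  by apply: cnt; case=> [k|k|k|k].
have eL : count is_CLR1 cs = count is_CLR1 cs' by lia.
split=> // p pP; rewrite (count_cored pP fcs) (count_cored pP fcs') eL (cnt (cored_pred p)) //.
by case=> k //= /andP[].
Qed.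

Definition total_size cs := sumn (map canon_size cs).

Lemma total_size_swap cs : total_size (map swap_canon cs) = total_size cs.
Proof. by elim: cs => [//|c cs]; rewrite /total_size /= => ->; case: c. Qed.

Lemma total_size_red cs :
  (total_size (map red_canon cs) + has shrinks_rows cs <= total_size cs)%N.
Proof.
elim: cs => [//|c cs]; rewrite /total_size /= => IH.
by case: c => [k|k|k|k] /=; move: IH; case: (has _ _); lia.
Qed.

Lemma total_size_cored cs :
  (total_size (map cored_canon cs) + has is_CLR cs <= total_size cs)%N.
Proof.
elim: cs => [//|c cs]; rewrite /total_size /= => IH.
by case: c => [k|k|k|k] /=; move: IH; case: (has _ _); lia.
Qed.

Lemma canon_sum_nil_top r (D : mat S r r) cs : ~~ has canon_pos cs ->
  top_equiv (canon_sum D cs) (MPair r r (idm r) D).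
Proof.
move=> cs0; apply: pair_equiv_top_equiv.
apply: lin_equiv_trans (pair_equiv_filter_pos D cs) _.
rewrite (_ : seq.filter _ _ = [::]); last first.
  by apply: size0nil; apply/eqP; rewrite size_filter -leqn0 leqNgt -has_count.
by rewrite canon_sumE !mx_of_dsum; apply: lin_equiv_diag2_0r.
Qed.

Lemma canon_flatP cs :
  ~~ has shrinks_rows cs -> ~~ has shrinks_rows (map swap_canon cs) -> all canon_flat cs.
Proof.
rewrite has_map -!all_predC => h1 h2; have := conj h1 h2 => /andP.
by rewrite -all_predI; apply: sub_all => c /=; case: c => k /=; lia.
Qed.

Lemma canon_flat_empty cs :
  all canon_flat cs -> ~~ has is_CLR cs -> ~~ has canon_pos cs.
Proof.
rewrite -!all_predC => h1 h2; have := conj h1 h2 => /andP.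
by rewrite -all_predI; apply: sub_all => c /=; rewrite /canon_pos; case: c => k /=; lia.
Qed.

Lemma canon_sum_invariants r (D : mat S r r) cs r' (D' : mat S r' r') cs' :
  nonsingular D -> nonsingular D' ->
  top_equiv (canon_sum D cs) (canon_sum D' cs') -> same_invariants D cs D' cs'.
Proof.
(* The total size is preserved by the swap and decreases under each reduction or coreduction below,
   since at least one of the two lists shrinks. *)
have [N] := ubnP (total_size cs + total_size cs').
elim: N r D cs r' D' cs' => [//|N IH] r D cs r' D' cs' ltN nD nD' te.
have [g|ng] := boolP (has shrinks_rows cs || has shrinks_rows cs').
  apply: (same_invariants_red te); apply: IH => //.
  have := total_size_red cs; have := total_size_red cs'.
  by case/orP: g => ->; lia.
have [g|ngs] := boolP (has shrinks_rows (map swap_canon cs) || has shrinks_rows (map swap_canon cs')).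
  have [E [DE ED]] := (nonsingularP D).1 nD; have [E' [DE' ED']] := (nonsingularP D').1 nD'.
  have nE : nonsingular (mat_of dist E) by apply/nonsingularP; exists (mx_of D); rewrite mat_ofK.
  have nE' : nonsingular (mat_of dist E') by apply/nonsingularP; exists (mx_of D'); rewrite mat_ofK.
  have tes : top_equiv (canon_sum (mat_of dist E) (map swap_canon cs))
                       (canon_sum (mat_of dist E') (map swap_canon cs')).
    have e1 : top_equiv (pair_swap (canon_sum D cs)) (canon_sum (mat_of dist E) (map swap_canon cs)).
      by apply/pair_equiv_top_equiv/canon_sum_swap; rewrite mat_ofK.
    have e2 : top_equiv (pair_swap (canon_sum D' cs')) (canon_sum (mat_of dist E') (map swap_canon cs')).
      by apply/pair_equiv_top_equiv/canon_sum_swap; rewrite mat_ofK.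
    apply: top_equiv_trans (top_equiv_sym e1) (top_equiv_trans _ e2).
    by move: te => [phi [psi [h1 [h2 [h3 h4]]]]]; exists phi, psi.
  have [|e [phi [hphi sim]] cnt] := same_invariants_red tes.
    apply: IH => //; have := total_size_red (map swap_canon cs).
    have := total_size_red (map swap_canon cs'); rewrite !total_size_swap.
    by case/orP: g => ->; lia.
  split=> //.
    (* The similarity found relates the inverses [E] and [E']; evaluated at [D v], it yields one
       between [D] and [D']. *)
    exists phi; split=> // v; have := sim (mulmv D v).
    rewrite !mulmvE !mat_ofK -mvM ED mv1 => ->.
    by rewrite -mvM DE' mv1.
  move=> p pP; have swapK : cancel swap_canon swap_canon by case.
  have := cnt (p \o swap_canon); rewrite !count_map.
  have ec cs0 : count (preim swap_canon (p \o swap_canon)) cs0 = count p cs0.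
    by apply: eq_count => c /=; rewrite swapK.
  by rewrite !ec; apply=> c /pP; case: c.
move: ng ngs; rewrite !negb_or => /andP[ng ng'] /andP[ngs ngs'].
have fcs := canon_flatP ng ngs; have fcs' := canon_flatP ng' ngs'.
have [g|nk] := boolP (has is_CLR cs || has is_CLR cs').
  apply: (same_invariants_cored nD nD' fcs fcs' te); apply: IH => //.
  have := total_size_cored cs; have := total_size_cored cs'.
  by case/orP: g => ->; lia.
move: nk; rewrite negb_or => /andP[nk nk'].
have n1 := canon_flat_empty fcs nk; have n2 := canon_flat_empty fcs' nk'.
have te' := top_equiv_trans (top_equiv_sym (canon_sum_nil_top D n1))
  (top_equiv_trans te (canon_sum_nil_top D' n2)).
move: te' => [phi [psi [hphi [hpsi [eI eD]]]]].
split; first exact: homeo_dim hphi.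
  (* The first matrices are identities, so [eI] says that [psi] and [phi] coincide. *)
  exists phi; split=> // v; move: (eI (mulmv D v)) (eD v) => /=.
  by rewrite !mulmvE !mx_of_id !mv1 => ->.
move=> p pP; have c0 l : ~~ has canon_pos l -> count p l = 0%N.
  move=> nl; apply/eqP; rewrite -leqn0 leqNgt -has_count.
  by apply: contra nl; apply: sub_has.
by rewrite !c0.
Qed.

Definition canon_eq_dec (c d : canon) : {c = d} + {c <> d}.
Proof. by decide equality; apply: PeanoNat.Nat.eq_dec. Defined.

(** The conjunct [canon_pos d] puts the counting predicate in the form accepted by
    [same_invariants]. *)
Lemma count_occ_pos cs c : Forall canon_valid cs ->
  count_occ canon_eq_dec cs c = count (fun d => canon_pos d && canon_eq_dec d c) cs.
Proof.
elim: cs => [//|d cs IH] /Forall_cons_iff[dv /IH]; rewrite /= /canon_pos dv => ->.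
by case: canon_eq_dec.
Qed.

Theorem pencil_classification m n (A B : mat S m n) :
  (exists (r : nat) (D : mat S r r) (cs : list canon),
     nonsingular D /\ Forall canon_valid cs /\
     top_equiv (MPair m n A B) (canon_sum D cs)) /\
  (forall (r : nat) (D : mat S r r) (cs : list canon)
          (r' : nat) (D' : mat S r' r') (cs' : list canon),
     nonsingular D -> Forall canon_valid cs ->
     nonsingular D' -> Forall canon_valid cs' ->
     top_equiv (MPair m n A B) (canon_sum D cs) ->
     top_equiv (MPair m n A B) (canon_sum D' cs') ->
     r = r' /\ top_similar D D' /\ length cs = length cs' /\ Permutation cs cs').
Proof.
split.
  have [r [D [cs [nD cs0 AB]]]] := pencil_decomposable dist (mx_of A) (mx_of B).
  exists r, D, cs; split=> //; split; last exact: pair_equiv_top_equiv.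
  by elim: cs cs0 {AB} => [//|c cs IH] /= /andP[c0 /IH]; constructor.
move=> r D cs r' D' cs' nD vcs nD' vcs' te te'.
have [e sim cnt] := canon_sum_invariants nD nD' (top_equiv_trans (top_equiv_sym te) te').
have perm : Permutation cs cs'.
  apply/(Permutation_count_occ canon_eq_dec) => c; rewrite !count_occ_pos //.
  by apply: cnt => d /andP[].
by split=> //; split=> //; split=> //; apply: Permutation_length.
Qed.

End Topological.

(** * The real and complex fields *)

(* An alias, because [R * R] already carries the componentwise ring structure. *)
Definition cplx : Type := (R * R)%type.
HB.instance Definition _ := Choice.copy cplx (R * R)%type.

Definition cplx_opp (x : cplx) : cplx := (- x.1, - x.2).
Definition cplx_inv (x : cplx) : cplx :=
  (x.1 / (x.1 ^+ 2 + x.2 ^+ 2), - x.2 / (x.1 ^+ 2 + x.2 ^+ 2)).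

Lemma cplx_addA : associative (Cadd : cplx -> cplx -> cplx).
Proof. by move=> x y z; rewrite /Cadd /= !RplusE !addrA. Qed.
Lemma cplx_addC : commutative (Cadd : cplx -> cplx -> cplx).
Proof. by move=> x y; rewrite /Cadd !RplusE (addrC x.1) (addrC x.2). Qed.
Lemma cplx_add0 : left_id ((0, 0) : cplx) Cadd.
Proof. by case=> a b; rewrite /Cadd /= !RplusE !add0r. Qed.
Lemma cplx_addN : left_inverse ((0, 0) : cplx) cplx_opp Cadd.
Proof. by case=> a b; rewrite /Cadd /= !RplusE !addNr. Qed.
HB.instance Definition _ := GRing.isZmodule.Build cplx cplx_addA cplx_addC cplx_add0 cplx_addN.

Lemma cplx_mulA : associative (Cmul : cplx -> cplx -> cplx).
Proof.
case=> [a b] [c d] [e f]; rewrite /Cmul /= !RplusE !RminusE !RmultE.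
by congr pair; ring.
Qed.
Lemma cplx_mulC : commutative (Cmul : cplx -> cplx -> cplx).
Proof.
case=> [a b] [c d]; rewrite /Cmul /= !RplusE !RminusE !RmultE.
by congr pair; ring.
Qed.
Lemma cplx_mul1 : left_id ((1, 0) : cplx) Cmul.
Proof.
case=> [a b]; rewrite /Cmul /= !RplusE !RminusE !RmultE.
by congr pair; ring.
Qed.
Lemma cplx_mulDl : left_distributive (Cmul : cplx -> cplx -> cplx) +%R.
Proof.
case=> [a b] [c d] [e f]; rewrite /GRing.add /= /Cadd /Cmul /= !RplusE !RminusE !RmultE.
by congr pair; ring.
Qed.
Lemma cplx_1neq0 : ((1, 0) : cplx) != 0.
Proof. by apply/eqP => -[] /eqP; rewrite oner_eq0. Qed.
HB.instance Definition _ := GRing.Zmodule_isComNzRing.Build cplx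
  cplx_mulA cplx_mulC cplx_mul1 cplx_mulDl cplx_1neq0.

Lemma cplx_mulV (x : cplx) : x != 0 -> cplx_inv x * x = 1.
Proof.
case: x => a b ab0; have n0 : a ^+ 2 + b ^+ 2 != 0.
  apply: contraNneq ab0 => /eqP; rewrite paddr_eq0 ?sqr_ge0 // !sqrf_eq0.
  by case/andP=> /eqP-> /eqP->.
rewrite /GRing.mul /= /Cmul /= !RplusE !RminusE !RmultE /GRing.one /=.
by congr pair; field.
Qed.
Lemma cplx_inv0 : cplx_inv 0 = 0.
Proof. by rewrite /cplx_inv /= oppr0 !mul0r. Qed.
HB.instance Definition _ := GRing.ComNzRing_isField.Build cplx cplx_mulV cplx_inv0.

Definition cplx_nrm (x : cplx) : R := sqrt (Rplus (Rmult x.1 x.1) (Rmult x.2 x.2)).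

Lemma cplx_nrmE x : cplx_nrm x = Num.sqrt (x.1 ^+ 2 + x.2 ^+ 2).
Proof. by rewrite /cplx_nrm RsqrtE !RplusE !RmultE -!expr2. Qed.

Lemma cplx_nrm_ge0 x : 0 <= cplx_nrm x.
Proof. by rewrite cplx_nrmE sqrtr_ge0. Qed.

Lemma cplx_nrmM x y : cplx_nrm (x * y) = cplx_nrm x * cplx_nrm y.
Proof.
rewrite !cplx_nrmE -sqrtrM ?addr_ge0 ?sqr_ge0 //; congr Num.sqrt.
by rewrite /GRing.mul /= /Cmul /= !RplusE !RminusE !RmultE; ring.
Qed.

Lemma cplx_nrmD x y : cplx_nrm (x + y) <= cplx_nrm x + cplx_nrm y.
Proof.
have n0 (z : cplx) : 0 <= z.1 ^+ 2 + z.2 ^+ 2 by rewrite addr_ge0 ?sqr_ge0.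
rewrite -(@ler_pXn2r _ 2) ?nnegrE ?addr_ge0 ?cplx_nrm_ge0 // sqrrD.
rewrite !cplx_nrmE !sqr_sqrtr //.
have cs : x.1 * y.1 + x.2 * y.2 <= Num.sqrt (x.1 ^+ 2 + x.2 ^+ 2) * Num.sqrt (y.1 ^+ 2 + y.2 ^+ 2).
  rewrite -sqrtrM // (le_trans (ler_norm _)) // -sqrtr_sqr ler_wsqrtr //.
  (* Lagrange's identity, which gives the Cauchy-Schwarz inequality in the plane. *)
  by rewrite -subr_ge0 (_ : _ - _ = (x.1 * y.2 - x.2 * y.1) ^+ 2) ?sqr_ge0 //; ring.
have xyE : (x + y).1 ^+ 2 + (x + y).2 ^+ 2 =
    x.1 ^+ 2 + x.2 ^+ 2 + (x.1 * y.1 + x.2 * y.2) *+ 2 + (y.1 ^+ 2 + y.2 ^+ 2).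
  by rewrite [x + y]/(Cadd x y) /Cadd /= !RplusE; ring.
by rewrite xyE lerD2r lerD2l lerMn2r cs.
Qed.

Lemma cplx_nrm_re x : `|x.1| <= cplx_nrm x.
Proof. by rewrite cplx_nrmE -sqrtr_sqr ler_wsqrtr // lerDl sqr_ge0. Qed.

Lemma cplx_nrm_im x : `|x.2| <= cplx_nrm x.
Proof. by rewrite cplx_nrmE -sqrtr_sqr ler_wsqrtr // lerDr sqr_ge0. Qed.

Lemma CdistE (x y : cplx) : Cdist x y = cplx_nrm (x - y).
Proof. by []. Qed.

Lemma cplx_nrm_le x : cplx_nrm x <= `|x.1| + `|x.2|.
Proof.
rewrite -(@ler_pXn2r _ 2) ?nnegrE ?addr_ge0 ?cplx_nrm_ge0 // cplx_nrmE.
rewrite sqr_sqrtr ?addr_ge0 ?sqr_ge0 // sqrrD !real_normK ?num_real //.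
by rewrite lerD2r lerDl mulrn_wge0 // mulr_ge0.
Qed.

(** * Invariance of dimension over both fields *)

Lemma real_homeo_dim n n' (f : vec RScalars n -> vec RScalars n') :
  homeomorphism f -> n = n'.
Proof.
move=> [g [fc [gc [fK gK]]]].
have cc a b (h : vec RScalars a -> vec RScalars b) : continuous_map h ->
    coord_continuous (h : ('I_a -> R) -> ('I_b -> R)).
  move=> /continuous_mapP hc x e /RltP e0; have [d [/RltP d0 hd]] := hc x e e0.
  by exists d => // y yx i; apply/RltP; rewrite -RabsE; apply: hd => j; apply/RltP/yx.
apply/eqP; rewrite eqn_leq (embedding_dimension (cc _ _ _ fc) (cc _ _ _ gc) fK).
by rewrite (embedding_dimension (cc _ _ _ gc) (cc _ _ _ fc) gK).
Qed.

Definition realify n (v : 'I_n -> cplx) (i : 'I_(n + n)) : R :=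
  match split i with inl a => (v a).1 | inr a => (v a).2 end.
Definition complexify n (v : 'I_(n + n) -> R) (i : 'I_n) : cplx :=
  (v (lshift n i), v (rshift n i)).

Lemma realifyK n : cancel (@realify n) (@complexify n).
Proof.
move=> v; apply/funext => i; rewrite /complexify /realify.
by rewrite (unsplitK (inl i)) (unsplitK (inr i)); case: (v i).
Qed.

Lemma complexifyK n : cancel (@complexify n) (@realify n).
Proof.
by move=> v; apply/funext => i; rewrite /realify; case: splitP => a ia;
   congr v; apply: val_inj.
Qed.

(** Complex n-space is read as real 2n-space, so the real theorem compares the doubled
    dimensions. *)
Lemma complex_homeo_dim n n' (f : vec CScalars n -> vec CScalars n') :
  homeomorphism f -> n = n'.
Proof.
move=> [g [fc [gc [fK gK]]]].
have cc a b (h : vec CScalars a -> vec CScalars b) : continuous_map h ->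
    coord_continuous (@realify b \o h \o @complexify a).
  move=> /continuous_mapP hc x e /RltP e0.
  have [d [/RltP d0 hd]] := hc (complexify x) e e0.
  (* The modulus is bounded by the sum of the absolute values of the two parts. *)
  exists (d / 2) => [|y yx i]; first by rewrite divr_gt0.
  have lt j : cplx_nrm ((h (complexify y) j : cplx) - h (complexify x) j) < e.
    apply/RltP; apply: hd => k; apply/RltP; rewrite [sdist _ _]CdistE.
    apply: le_lt_trans (cplx_nrm_le _) _; rewrite [ltRHS]splitr ltrD //.
      exact: yx.
    exact: yx.
  rewrite /= /realify; case: split => j.
    exact: le_lt_trans (cplx_nrm_re _) (lt j).
  exact: le_lt_trans (cplx_nrm_im _) (lt j).
have dim a b (h : vec CScalars a -> vec CScalars b) h' : continuous_map h ->
    continuous_map h' -> cancel h h' -> (a <= b)%N.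
  move=> /cc h1 /cc h2 hK; have := embedding_dimension h1 h2.
  have hh : cancel (@realify b \o h \o @complexify a) (@realify a \o h' \o @complexify b).
    by move=> v /=; rewrite realifyK hK complexifyK.
  by move=> /(_ hh); rewrite !addnn leq_double.
by apply/eqP; rewrite eqn_leq (dim _ _ _ _ fc gc fK) (dim _ _ _ _ gc fc gK).
Qed.

Theorem theorem1 (k : base_field) (m n : nat) (A B : mat (scal k) m n) :
  (exists (r : nat) (D : mat (scal k) r r) (cs : list canon),
     nonsingular D /\ Forall canon_valid cs /\
     top_equiv (MPair m n A B) (canon_sum D cs)) /\
  (forall (r : nat) (D : mat (scal k) r r) (cs : list canon)
          (r' : nat) (D' : mat (scal k) r' r') (cs' : list canon),
     nonsingular D -> Forall canon_valid cs ->
     nonsingular D' -> Forall canon_valid cs' ->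
     top_equiv (MPair m n A B) (canon_sum D cs) ->
     top_equiv (MPair m n A B) (canon_sum D' cs') ->
     r = r' /\ top_similar D D' /\ length cs = length cs' /\ Permutation cs cs').
Proof.
case: k A B => A B.
  apply: (@pencil_classification R (fun x y => Rabs (Rminus x y)) (fun x => `|x|)).
  - by move=> x y; rewrite RabsE.
  - exact: normr0.
  - exact: normr_ge0.
  - exact: ler_normD.
  - by move=> x y; rewrite normrM.
  - exact: real_homeo_dim.
apply: (@pencil_classification cplx Cdist cplx_nrm).
- exact: CdistE.
- by rewrite cplx_nrmE /= expr0n addr0 sqrtr0.
- exact: cplx_nrm_ge0.
- exact: cplx_nrmD.
- by move=> x y; rewrite cplx_nrmM.
- exact: complex_homeo_dim.
Qed.
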